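(* Let $\alpha_h\in A_h$ be given. Then the problem of finding $u_h\in U_{i,h}$ such that $$\mathcal{U}_h(\alpha_h;u_h,v_h)=0\quad\forall v_h\in U_{0,h}$$ admits a unique solution.
   Context: **Continuous setting.** $\Omega\subset\mathbb{R}^d$ ($d=2,3$) is a bounded polyhedral domain which can be perfectly fitted by simplicial meshes. Its boundary is partitioned as $\partial\Omega=\partial\Omega_D\cup\partial\Omega_N$ with $\partial\Omega_D$ closed and of positive $(d-1)$-dimensional measure, and $\partial\Omega_N$ open in $\partial\Omega$. $\mathbb{C}=\lambda\mathbf{1}\otimes\mathbf{1}+2\mu\mathbf{1}_4$ is the isotropic Hooke tensor with Lamé coefficients $\lambda,\mu$ ($\mathbf 1$, $\mathbf 1_4$ the unit tensors of orders 2 and 4), positive definite on symmetric matrices. The constants $\eta_\ell>0$ and $\zeta>0$ are fixed. $a:\mathbb{R}\to[0,\infty)$ is a $\mathcal{C}^1$ function, monotonic on $[0,1]$, with $a(0)=1$ and $a(1)=0$. The Dirichlet datum is $w_i\in(H^{1/2}(\partial\Omega))^d$, and $f_i\in(H^1(\Omega))^d$ is a fixed function with $f_i=w_i$ on $\partial\Omega_D$. **Mesh.** $\mathcal{T}_h$ is a matching simplicial mesh of $\Omega$, $\mathcal{F}_h^i$ is the set of its internal facets and $h_F$ is the diameter of the facet $F$. For $F\in\mathcal{F}^i_h$, $c_{F,+}$ and $c_{F,-}$ are the two cells sharing $F$, $n_F$ is the unit normal to $F$ directed from $c_{F,+}$ towards $c_{F,-}$, and $[u]_F=u_{c_{F,+}}-u_{c_{F,-}}$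 is the jump across $F$ ($u_c$ being the restriction of $u$ to $c$). For a cellwise-defined quantity $q$, $\langle q\rangle_F=\frac12(q_{c_{F,-}}+q_{c_{F,+}})$. $\nabla_h$ is the broken (cellwise) gradient, $\mathrm{e}_h$ its symmetric part, and $\sigma_h(u)=\mathbb{C}\mathrm{e}_h(u)$. **Discrete spaces.** $\mathbb{P}^1(\mathcal{T}_h)$ and $\mathbb{P}^1_d(\mathcal{T}_h)$ are the spaces of discontinuous, cellwise affine functions with values in $\mathbb{R}$ and $\mathbb{R}^d$ respectively, and $\pi_h$ is the $L^2$-orthogonal projection onto $\mathbb{P}^1_d(\mathcal{T}_h)$. Then $U_{i,h}=\{u_h\in\mathbb{P}^1_d(\mathcal{T}_h): u_h=\pi_hf_i\text{ on }\partial\Omega_D\}$, $U_{0,h}=\{u_h\in\mathbb{P}^1_d(\mathcal{T}_h): u_h=0\text{ on }\partial\Omega_D\}$, $A_h=\{\alpha_h\in\mathbb{P}^1(\mathcal{T}_h):\int_F[\alpha_h]_F\,dS=0\ \forall F\in\mathcal{F}_h^i,\ \alpha_h=0\text{ on }\partial\Omega_D\}$ (Crouzeix–Raviart space). **Discrete form.** Let $\Pi_h$ be the $L^2$-orthogonal projection onto cellwise constant functions and $a_h(\alpha_h)=\Pi_h a(\alpha_h)$. For a cellwise tensor field $\tau$ set $$\{\tau\cdot n_F\}_{w,F}=\frac{\langle (a_h(\alpha_h)+\eta_\ell)\,\tau\cdot n_F\rangle_F}{\langle a_h(\alpha_h)+\eta_\ell\rangle_F},\qquad \gamma_F=\frac{(a_h(\alpha_h)_{c_{F,+}}+\eta_\ell)(a_h(\alpha_h)_{c_{F,-}}+\eta_\ell)}{\langle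 a_h(\alpha_h)+\eta_\ell\rangle_F}.$$ Then $$\begin{aligned}\mathcal{U}_h(\alpha_h;u_h,v_h)=&\int_\Omega(a_h(\alpha_h)+\eta_\ell)\mathbb{C}\mathrm{e}_h(u_h)\cdot\mathrm{e}_h(v_h)\,dx\\&-\sum_{F\in\mathcal{F}_h^i}\int_F\Big(\{(a_h(\alpha_h)+\eta_\ell)\sigma_h(u_h)\cdot n_F\}_{w,F}\cdot[v_h]_F-\{(a_h(\alpha_h)+\eta_\ell)\sigma_h(v_h)\cdot n_F\}_{w,F}\cdot[u_h]_F\Big)dS\\&+\sum_{F\in\mathcal{F}_h^i}\frac{\zeta}{h_F}\gamma_F\int_F[u_h]_F\cdot[v_h]_F\,dS.\end{aligned}$$ *)

(* Defs.v *)
From HB Require Import structures.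
From mathcomp Require Import all_boot all_order all_algebra.
From mathcomp Require Import all_classical all_reals all_analysis.
Set Implicit Arguments. Unset Strict Implicit. Unset Printing Implicit Defensive.
Import Order.TTheory GRing.Theory Num.Theory numFieldNormedType.Exports.
Local Open Scope classical_set_scope.
Local Open Scope ring_scope.

(* R^n carries the product sigma-algebra, generated by the coordinates; it is the
   Borel sigma-algebra. *)
Section measurable_rV.
Context (R : realType) (n : nat).
Let coor (i : 'I_n) (x : 'rV[R]_n) : measurableTypeR R := x ord0 i.

Let rV_set0 : g_sigma_preimage coor set0.
Proof. exact: sigma_algebra0. Qed.
Let rV_setC A : g_sigma_preimage coor A -> g_sigma_preimage coor (~` A).
Proof. exact: sigma_algebraC. Qed.
Let rV_bigcup (F : (set 'rV[R]_n)^nat) : (forall i, g_sigma_preimage coor (F i)) ->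
  g_sigma_preimage coor (\bigcup_i F i).
Proof. exact: sigma_algebra_bigcup. Qed.
HB.instance Definition _ := @isMeasurable.Build default_measure_display 'rV[R]_n
  (g_sigma_preimage coor) rV_set0 rV_setC rV_bigcup.

Lemma measurable_coor (i : 'I_n) :
  measurable_fun setT (fun x : 'rV[R]_n => x ord0 i : measurableTypeR R).
Proof.
move=> _ Y mY; rewrite setTI; apply: sub_sigma_algebra.
rewrite -bigcup_seq/=; exists i => /=; first by rewrite mem_index_enum.
by exists Y => //; rewrite setTI.
Qed.

Lemma measurable_fun_rV d (T : measurableType d) (f : T -> 'rV[R]_n) :
  (forall i, measurable_fun setT (fun t => f t ord0 i : measurableTypeR R)) ->
  measurable_fun setT f.
Proof.
move=> mf _ A mA; rewrite setTI; move: A mA.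
apply: smallest_sub => /=.
  split => /=.
  - by rewrite preimage_set0; exact: measurable0.
  - by move=> A mA; rewrite setTD preimage_setC; exact: measurableC.
  - by move=> F mF; rewrite preimage_bigcup; exact: bigcupT_measurable.
move=> A; rewrite -bigcup_seq => -[i _ [B mB <-]].
by rewrite setTI -[X in measurable X]setTI; exact: (mf i).
Qed.
End measurable_rV.

Section lebesgue_rV_succ.
Context (R : realType) (n : nat).

Definition rV_cons (p : measurableTypeR R * 'rV[R]_n) : 'rV[R]_n.+1 :=
  \row_i oapp (fun j => p.2 ord0 j) p.1 (unlift ord0 i).

Definition rV_uncons (x : 'rV[R]_n.+1) : measurableTypeR R * 'rV[R]_n :=
  (x ord0 ord0, \row_i x ord0 (lift ord0 i)).

Lemma rV_consK : cancel rV_cons rV_uncons.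
Proof.
move=> [a v]; rewrite /rV_uncons mxE unlift_none /=; congr pair.
by apply/rowP => i; rewrite !mxE liftK.
Qed.

Lemma measurable_rV_cons : measurable_fun setT rV_cons.
Proof.
apply: measurable_fun_rV => i; case: (unliftP ord0 i) => [j|] ->.
  under eq_fun do rewrite mxE liftK /=.
  exact: (measurableT_comp (measurable_coor j) measurable_snd).
under eq_fun do rewrite mxE unlift_none /=.
exact: measurable_fst.
Qed.

Lemma measurable_rV_uncons : measurable_fun setT rV_uncons.
Proof.
apply/measurable_fun_pairP; split; first exact: measurable_coor.
apply: measurable_fun_rV => i.
under eq_fun do rewrite /= mxE.
exact: measurable_coor.
Qed.

Variable mu : {sigma_finite_measure set 'rV[R]_n -> \bar R}.

Definition lebesgue_rV_succ : set 'rV[R]_n.+1 -> \bar R :=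
  pushforward (@lebesgue_measure R \x mu)%E rV_cons.

Let preimage_consT (A : set 'rV[R]_n.+1) :
  measurable A -> measurable (rV_cons @^-1` A).
Proof.
by move=> mA; rewrite -[X in measurable X]setTI; exact: measurable_rV_cons.
Qed.

Let lebesgue_rV_succ0 : lebesgue_rV_succ set0 = 0%E.
Proof. by rewrite /lebesgue_rV_succ /pushforward preimage_set0 measure0. Qed.

Let lebesgue_rV_succ_ge0 A : (0 <= lebesgue_rV_succ A)%E.
Proof. by rewrite /lebesgue_rV_succ /pushforward measure_ge0. Qed.

Let lebesgue_rV_succ_sigma_additive : semi_sigma_additive lebesgue_rV_succ.
Proof.
move=> F mF tF mUF; rewrite /lebesgue_rV_succ /pushforward preimage_bigcup.
apply: measure_semi_sigma_additive.
- by move=> i; exact: preimage_consT.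
- apply/trivIsetP => /= i j _ _ ij; rewrite -preimage_setI.
  by move/trivIsetP : tF => /(_ _ _ _ _ ij) ->//; rewrite preimage_set0.
- by rewrite -preimage_bigcup; exact: preimage_consT.
Qed.

HB.instance Definition _ := isMeasure.Build _ _ _ lebesgue_rV_succ
  lebesgue_rV_succ0 lebesgue_rV_succ_ge0 lebesgue_rV_succ_sigma_additive.

Let lebesgue_rV_succ_sigma_finite : sigma_finite setT lebesgue_rV_succ.
Proof.
have /sigma_finiteP[F [FT ndF mF]] := sigma_finiteT (@lebesgue_measure R).
have /sigma_finiteP[G [GT ndG mG]] := sigma_finiteT mu.
exists (fun k => rV_uncons @^-1` (F k `*` G k)).
  rewrite -preimage_bigcup -[LHS](preimage_setT rV_uncons); congr preimage.
  rewrite predeqE => -[x y]; split=> // _.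
  have [i _ Fix] : (\bigcup_i F i) x by rewrite -FT.
  have [j _ Gjy] : (\bigcup_i G i) y by rewrite -GT.
  exists (maxn i j) => //; split => /=.
  - by move: Fix; exact/subsetPset/ndF/leq_maxl.
  - by move: Gjy; exact/subsetPset/ndG/leq_maxr.
move=> k; have [mFk Fky] := mF k; have [mGk Gky] := mG k; split.
  rewrite -[X in measurable X]setTI; apply: measurable_rV_uncons => //.
  exact: measurableX.
rewrite /lebesgue_rV_succ /pushforward -comp_preimage.
have -> : rV_uncons \o rV_cons = id by apply/funext => p; exact: rV_consK.
by rewrite preimage_id product_measure1E// lte_mul_pinfty// ge0_fin_numE.
Qed.

HB.instance Definition _ := Measure_isSigmaFinite.Build _ _ _ lebesgue_rV_succ
  lebesgue_rV_succ_sigma_finite.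

End lebesgue_rV_succ.

(* The n-dimensional Lebesgue measure, as an iterated product measure. *)
Fixpoint lebesgue_rV (R : realType) (n : nat) :
    {sigma_finite_measure set 'rV[R]_n -> \bar R} :=
  match n with
  | 0 => dirac (0 : 'rV[R]_0)
  | m.+1 => lebesgue_rV_succ (lebesgue_rV R m)
  end.

Section euclidean.
Context (R : realType) (d : nat).
Implicit Types (x y : 'rV[R]_d) (A B e : 'M[R]_d).

Definition dot x y : R := \sum_i x ord0 i * y ord0 i.

(* The library norm of 'rV[R]_d is the sup norm: it is used for the topology
   only. *)
Definition enorm x : R := Num.sqrt (dot x x).

Definition ddot A B : R := \sum_i \sum_j A i j * B i j.

Definition tensor_vec A x : 'rV[R]_d := x *m A^T.

Definition hooke (lambda mu : R) e : 'M[R]_d :=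
  (lambda * \tr e)%:M + (2 * mu) *: e.

Definition hooke_posdef (lambda mu : R) : Prop :=
  forall e, e^T = e -> e != 0 -> 0 < ddot (hooke lambda mu e) e.

Definition is_affine (V : lmodType R) (f : 'rV[R]_d -> V) : Prop :=
  exists (L : {linear 'rV[R]_d -> V}) (b : V), forall x, f x = L x + b.

Definition boundary (A : set 'rV[R]_d) : set 'rV[R]_d := closure A `\` A°.

(* [(closure Omega)° = Omega] says that Omega lies locally on one side of its
   boundary (no cracks). *)
Definition polyhedral_domain (Omega : set 'rV[R]_d) : Prop :=
  [/\ [/\ open Omega, connected Omega & Omega !=set0],
      bounded_set Omega,
      (closure Omega)° = Omega &
      exists planes : seq ('rV[R]_d * R),
        (forall p, p \in planes -> p.1 != 0) /\
        boundary Omega `<=` [set x | exists2 p, p \in planes & dot p.1 x = p.2]].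

End euclidean.

(* A simplex is given by the set of (the indices of) its vertices. *)
Record mesh (R : realType) (d : nat) := Mesh {
  nvert : nat;
  ncell : nat;
  vert : 'I_nvert -> 'rV[R]_d;
  cell : 'I_ncell -> {set 'I_nvert} }.

Section mesh_geometry.
Context (R : realType) (d : nat) (T : mesh R d).
Implicit Types (S F : {set 'I_(nvert T)}) (c : 'I_(ncell T)).

Definition hull S : set 'rV[R]_d :=
  [set x | exists w : 'I_(nvert T) -> R,
    [/\ forall i, 0 <= w i, \sum_(i in S) w i = 1 &
        x = \sum_(i in S) w i *: vert i]].

Definition affinely_independent S : Prop :=
  forall w : 'I_(nvert T) -> R,
    \sum_(i in S) w i = 0 -> \sum_(i in S) w i *: vert i = 0 ->
    forall i, i \in S -> w i = 0.

Definition matching_mesh_of (Omega : set 'rV[R]_d) : Prop :=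
  [/\ injective (@cell R d T),
      forall c, #|cell c| = d.+1 /\ affinely_independent (cell c),
      forall c c',
        hull (cell c) `&` hull (cell c') = hull (cell c :&: cell c') &
      closure Omega = \bigcup_c hull (cell c)].

Definition cells_of F : {set 'I_(ncell T)} := [set c | F \subset cell c].

Definition internal_facets : {set {set 'I_(nvert T)}} :=
  [set F : {set 'I_(nvert T)} | (#|F| == d) && (1 < #|cells_of F|)%N].

Definition boundary_facets : {set {set 'I_(nvert T)}} :=
  [set F : {set 'I_(nvert T)} | (#|F| == d) && (#|cells_of F| == 1%N)].

Definition diameter F : R :=
  sup [set r | exists x y, [/\ hull F x, hull F y & r = enorm (x - y)]].

(* The interior of the simplex is used as integration domain because data such
   as [f] below are functions on the open set Omega only. *)
Definition cell_int c (g : 'rV[R]_d -> R) : R :=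
  \int[lebesgue_rV R d]_(x in (hull (cell c))°) g x.

(* Facets have d vertices v_0, ..., v_(d-1) and are parametrized over the unit
   simplex of R^(d-1) by t |-> v_0 + \sum_i t_i (v_(i+1) - v_0). *)
Definition facet_vert F (i : nat) : 'rV[R]_d :=
  nth 0 [seq vert j | j <- enum F] i.

Definition facet_edge F (i : 'I_d.-1) : 'rV[R]_d :=
  facet_vert F i.+1 - facet_vert F 0.

Definition facet_param F (t : 'rV[R]_d.-1) : 'rV[R]_d :=
  facet_vert F 0 + \sum_i t ord0 i *: facet_edge F i.

Definition unit_simplex : set 'rV[R]_d.-1 :=
  [set t | (forall i, 0 <= t ord0 i) /\ \sum_i t ord0 i <= 1].

Definition facet_jacobian F : R :=
  Num.sqrt (\det (\matrix_(i, j) dot (facet_edge F i) (facet_edge F j))).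

(* Integral over F with respect to the (d-1)-dimensional measure dS. *)
Definition facet_integral F (g : 'rV[R]_d -> \bar R) : \bar R :=
  ((facet_jacobian F)%:E *
   \int[lebesgue_rV R d.-1]_(t in unit_simplex) g (facet_param F t))%E.

Definition facet_int F (g : 'rV[R]_d -> R) : R :=
  fine (facet_integral F (EFin \o g)).

Definition ae_facet F (P : 'rV[R]_d -> Prop) : Prop :=
  {ae lebesgue_rV R d.-1, forall t, unit_simplex t -> P (facet_param F t)}.

(* The (d-1)-dimensional measure of subsets of the boundary of the meshed domain,
   which is the union of the boundary facets. *)
Definition boundary_measure (A : set 'rV[R]_d) : \bar R :=
  (\sum_(F in boundary_facets) facet_integral F (fun x => (\1_A x)%:E))%E.

Record orientation := Orientation {
  cplus : {set 'I_(nvert T)} -> 'I_(ncell T);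
  cminus : {set 'I_(nvert T)} -> 'I_(ncell T);
  normal : {set 'I_(nvert T)} -> 'rV[R]_d }.

Definition well_oriented (o : orientation) : Prop :=
  forall F, F \in internal_facets ->
  [/\ [/\ F \subset cell (cplus o F), F \subset cell (cminus o F)
          & cplus o F != cminus o F],
      enorm (normal o F) = 1,
      forall x y, hull F x -> hull F y -> dot (normal o F) (y - x) = 0,
      forall x y, hull F x -> hull (cell (cplus o F)) y ->
        dot (normal o F) (y - x) <= 0 &
      forall x y, hull F x -> hull (cell (cminus o F)) y ->
        0 <= dot (normal o F) (y - x)].

End mesh_geometry.

Section sobolev.
Context (R : realType) (d : nat) (Omega : set 'rV[R]_d).
Implicit Types (f g phi : 'rV[R]_d -> R) (G : 'rV[R]_d -> 'rV[R]_d).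

Definition partial (j : 'I_d) f (x : 'rV[R]_d) : R := 'D_(delta_mx ord0 j) f x.

Fixpoint Ck (k : nat) f : Prop :=
  if k is k'.+1 then
    (forall x, differentiable f x) /\ forall j, Ck k' (partial j f)
  else continuous f.

Definition smooth f : Prop := forall k, Ck k f.

Definition L2 f : Prop :=
  measurable_fun Omega f /\
  (lebesgue_rV R d).-integrable Omega (fun x => (f x ^+ 2)%:E).

Definition test_function phi : Prop :=
  smooth phi /\ exists K : set 'rV[R]_d,
    [/\ compact K, K `<=` Omega & forall x, ~ K x -> phi x = 0].

Definition weak_partial (j : 'I_d) f g : Prop :=
  forall phi, test_function phi ->
    \int[lebesgue_rV R d]_(x in Omega) (f x * partial j phi x) =
    - \int[lebesgue_rV R d]_(x in Omega) (g x * phi x).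

Definition weak_gradient f G : Prop :=
  forall j, L2 (fun x => G x ord0 j) /\ weak_partial j f (fun x => G x ord0 j).

Definition H1 f : Prop := L2 f /\ exists G, weak_gradient f G.

Definition sqdist_L2 f g : \bar R :=
  \int[lebesgue_rV R d]_(x in Omega) ((f x - g x) ^+ 2)%:E.

(* [g] is the trace on the boundary of [f]: the trace operator is the continuous
   extension to H^1(Omega) of the restriction of smooth functions to the
   boundary, with values in L^2 of the boundary. *)
Definition is_trace (T : mesh R d) f g : Prop :=
  [/\ L2 f,
      forall F, F \in boundary_facets T ->
        measurable_fun (@unit_simplex R d) (g \o facet_param F) &
      exists G (phi : nat -> 'rV[R]_d -> R),
        [/\ weak_gradient f G,
            forall k, smooth (phi k),
            sqdist_L2 (phi k) f @[k --> \oo] --> 0%E,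
            forall j, sqdist_L2 (partial j (phi k)) (fun x => G x ord0 j)
                        @[k --> \oo] --> 0%E &
            (\sum_(F in boundary_facets T)
               facet_integral F (fun x => ((phi k x - g x) ^+ 2)%:E))%E
                        @[k --> \oo] --> 0%E]].

Definition H1_vec (f : 'rV[R]_d -> 'rV[R]_d) : Prop :=
  forall i, H1 (fun x => f x ord0 i).

Definition is_trace_vec (T : mesh R d) (f g : 'rV[R]_d -> 'rV[R]_d) : Prop :=
  forall i, is_trace T (fun x => f x ord0 i) (fun x => g x ord0 i).

(* H^(1/2) of the boundary is the range of the trace operator on H^1(Omega). *)
Definition H12_vec (T : mesh R d) (w : 'rV[R]_d -> 'rV[R]_d) : Prop :=
  exists2 f, H1_vec f & is_trace_vec T f w.

Definition trace_eq_on (T : mesh R d) (gammaD : set 'rV[R]_d)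
    (f w : 'rV[R]_d -> 'rV[R]_d) : Prop :=
  exists2 tr, is_trace_vec T f tr &
    forall F, F \in boundary_facets T ->
      ae_facet F (fun x => gammaD x -> tr x = w x).

End sobolev.

Section discrete_problem.
Context (R : realType) (d : nat) (T : mesh R d).

(* Cellwise-defined quantities: [u c] is the restriction of [u] to the cell [c].
   An affine function on a cell is identified with its unique affine extension
   to the whole space. *)
Definition field (V : Type) := 'I_(ncell T) -> 'rV[R]_d -> V.

Definition P1 (V : lmodType R) : set (field V) :=
  [set u | forall c, is_affine (u c)].

Definition P1s : set (field R) := P1 (V := R^o).
Definition P1v : set (field 'rV[R]_d) := P1 (V := 'rV[R]_d).

(* Equality of the traces from the cells, almost everywhere on [gammaD]. *)
Definition eq_on (V : Type) (gammaD : set 'rV[R]_d) (u v : field V) : Prop :=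
  forall c F, F \in boundary_facets T -> F \subset cell c ->
    ae_facet F (fun x => gammaD x -> u c x = v c x).

(* L^2-orthogonal projections onto P1v and onto cellwise constant functions; the
   latter are represented by their values on the cells. *)
Definition pi_h (f : 'rV[R]_d -> 'rV[R]_d) : field 'rV[R]_d :=
  xget (fun _ _ => 0)
    [set p | P1v p /\ forall v, P1v v ->
      \sum_c cell_int c (fun x => dot (f x - p c x) (v c x)) = 0].

Definition Pi_h (q : field R) : 'I_(ncell T) -> R :=
  xget (fun=> 0)
    [set p | forall z : 'I_(ncell T) -> R,
      \sum_c cell_int c (fun x => (q c x - p c) * z c) = 0].

Variable o : orientation T.
Implicit Types (F : {set 'I_(nvert T)}).

Definition jump (V : zmodType) F (u : field V) (x : 'rV[R]_d) : V :=
  u (cplus o F) x - u (cminus o F) x.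

Definition avg (V : lmodType R) F (q : 'I_(ncell T) -> V) : V :=
  2^-1 *: (q (cminus o F) + q (cplus o F)).

Variable gammaD : set 'rV[R]_d.

Definition U_i_h (f : 'rV[R]_d -> 'rV[R]_d) : set (field 'rV[R]_d) :=
  [set u | P1v u /\ eq_on gammaD u (pi_h f)].

Definition U_0_h : set (field 'rV[R]_d) :=
  [set u | P1v u /\ eq_on gammaD u (fun _ _ => 0)].

Definition A_h : set (field R) :=
  [set alpha | [/\ P1s alpha,
    forall F, F \in internal_facets T -> facet_int F (jump F alpha) = 0 &
    eq_on gammaD alpha (fun _ _ => 0)]].

Variables (lambda mu eta zeta : R) (a : R -> R) (alpha : field R).

Definition a_h : 'I_(ncell T) -> R := Pi_h (fun c x => a (alpha c x)).

(* 'J is the Jacobian acting on row vectors, hence the transpose: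
   (grad u)_ij = d_j u_i. *)
Definition grad_h (u : field 'rV[R]_d) : field 'M[R]_d :=
  fun c x => ('J (u c) x)^T.

Definition e_h (u : field 'rV[R]_d) : field 'M[R]_d :=
  fun c x => 2^-1 *: (grad_h u c x + (grad_h u c x)^T).

Definition sigma_h (u : field 'rV[R]_d) : field 'M[R]_d :=
  fun c x => hooke lambda mu (e_h u c x).

Definition avg_weight F : R := avg F (fun c => a_h c + eta : R^o).

(* The weighted average, to be applied to tau = (a_h + eta) sigma_h in form_h,
   where the weight thus occurs twice. *)
Definition wavg F (tau : field 'M[R]_d) (x : 'rV[R]_d) : 'rV[R]_d :=
  (avg_weight F)^-1 *:
    avg F (fun c => (a_h c + eta) *: tensor_vec (tau c x) (normal o F)).

Definition gamma_h F : R :=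
  (a_h (cplus o F) + eta) * (a_h (cminus o F) + eta) / avg_weight F.

Definition form_h (u v : field 'rV[R]_d) : R :=
  \sum_c cell_int c (fun x =>
    (a_h c + eta) * ddot (hooke lambda mu (e_h u c x)) (e_h v c x))
  - \sum_(F in internal_facets T) facet_int F (fun x =>
      dot (wavg F (fun c y => (a_h c + eta) *: sigma_h u c y) x) (jump F v x)
      - dot (wavg F (fun c y => (a_h c + eta) *: sigma_h v c y) x) (jump F u x))
  + \sum_(F in internal_facets T) zeta / diameter F * gamma_h F *
      facet_int F (fun x => dot (jump F u x) (jump F v x)).

End discrete_problem.

(* Main.v *)
(* The admissible displacements form an affine space directed by U_0_h, which has
   finite dimension, so it suffices that form_h is definite on U_0_h. On the
   diagonal the consistency terms cancel, and what remains is a sum of nonnegative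
   terms: if it vanishes, then the displacement v is a rigid motion on each cell
   and its jumps vanish on the internal facets. A rigid motion vanishing on d
   affinely independent points is zero, so the restrictions of v to two cells that
   share a facet coincide. As Omega is connected, any two cells are joined by a
   chain of cells sharing facets: sets of cells meeting only along faces of
   codimension at least 2 cannot separate a ball, because generic segments avoid
   such faces. Hence v is one rigid motion, and it vanishes on a non-null part of
   some boundary facet, hence on the vertices of that facet; so v = 0. *)
Require Import Defs.
From HB Require Import structures.
From mathcomp Require Import all_boot all_order all_algebra.
From mathcomp Require Import all_classical all_reals all_analysis.
From mathcomp Require Import measurable_realfun.
From mathcomp Require Import ring lra.
Set Implicit Arguments. Unset Strict Implicit. Unset Printing Implicit Defensive.
Import Order.TTheory GRing.Theory Num.Theory numFieldNormedType.Exports.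
Local Open Scope classical_set_scope.
Local Open Scope ring_scope.

(** * Lebesgue measure on row vectors *)

(** Linearity of the integral is available only where integrability is known, so the argument runs
    on affine fields encoded by their coefficients ([coefs]): there the cell integrands of [form_h]
    are constants and the facet integrands are continuous. The form is not symmetric, hence
    solvability comes from an invertible Gram matrix and not from a minimisation. [Pi_h] and [pi_h]
    are choices with a default value; what is used of them, that [a_h] is nonnegative and that
    [pi_h f] is affine on each cell, holds for the chosen element and for the default alike. The
    constant [eta] keeps the weights positive where [a_h] vanishes. An internal facet is only known
    to lie in at least two cells, whereas the jumps see just the two cells named by the orientation:
    that there is no third one is a fact about matching simplices, [simplices_not_same_side]. Zero
    sets of nontrivial affine functions are null sets; this yields the generic points, and it also
    turns vanishing almost everywhere on a non-null part of a facet into vanishing at its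
    vertices. *)

Section lebesgue_rV_theory.
Context {R : realType}.
Local Notation lam := (lebesgue_rV R).

Definition rV_box n (A : 'I_n -> set (measurableTypeR R)) : set 'rV[R]_n :=
  [set x | forall i, A i (x ord0 i)].

Lemma measurable_rV_box n (A : 'I_n -> set (measurableTypeR R)) :
  (forall i, measurable (A i)) -> measurable (rV_box A).
Proof.
move=> mA; have -> : rV_box A =
    \bigcap_(i in [set: 'I_n]) ((fun x : 'rV[R]_n => x ord0 i) @^-1` A i).
  by apply/seteqP; split=> [x xA i _|x xA i]; exact: xA.
apply: fin_bigcap_measurable => // i _.
by rewrite -[X in measurable X]setTI; apply: measurable_coor => //; exact: mA.
Qed.

(** The sigma-algebra is generated by the coordinates; an open set belongs to it as the countable
    union of the boxes with rational corners that it contains. *)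
Lemma open_measurable_rV n (U : set 'rV[R]_n) : open U -> measurable U.
Proof.
move=> oU.
pose B (q : {ffun 'I_n -> rat} * {ffun 'I_n -> rat}) : set 'rV[R]_n :=
  rV_box (fun i => [set` `]ratr (q.1 i), ratr (q.2 i)[]).
have -> : U = \bigcup_q (if `[< B q `<=` U >] then B q else set0).
  apply/seteqP; split=> x /=; last first.
    by case=> q _; case: asboolP => // BU /BU.
  move=> Ux; have /nbhs_ballP[e /= e0 eU] : nbhs x U by exact: open_nbhs_nbhs.
  have /choice[q1 q1P] i : exists q : rat, ratr q \in `](x ord0 i - e), (x ord0 i)[.
    by apply: rat_in_itvoo; rewrite ltrBlDr ltrDl.
  have /choice[q2 q2P] i : exists q : rat, ratr q \in `](x ord0 i), (x ord0 i + e)[.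
    by apply: rat_in_itvoo; rewrite ltrDl.
  exists ([ffun i => q1 i], [ffun i => q2 i]) => //.
  rewrite asboolT => [i|y By].
    rewrite /= in_itv/= !ffunE.
    by move: (q1P i) (q2P i); rewrite !in_itv/= => /andP[_ ->] /andP[->].
  apply: eU; split=> // i j; rewrite (ord1 i) /ball/=.
  have := By j; rewrite /= in_itv/= !ffunE => /andP[y1 y2].
  move: (q1P j) (q2P j); rewrite !in_itv/= => /andP[a1 a2] /andP[b1 b2].
  by rewrite ltr_norml; apply/andP; split; lra.
apply: countable_bigcupT_measurable => [|q]; first exact: countableP.
case: asboolP => // _; apply: measurable_rV_box => i; exact: measurable_itv.
Qed.

Lemma closed_measurable_rV n (C : set 'rV[R]_n) : closed C -> measurable C.
Proof.
by move=> /closed_openC/open_measurable_rV/measurableC; rewrite setCK.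
Qed.

Lemma continuous_measurable_rV n (g : 'rV[R]_n -> R) :
  continuous g -> measurable_fun setT (g : _ -> measurableTypeR R).
Proof.
move=> /continuousP cg; apply: (measurability _ (RGenOpens.measurableE R)).
move=> /= _ [_ [a [b ->] <-]].
rewrite setTI; apply: open_measurable_rV; apply: (cg [set` `]a, b[]); exact: interval_open.
Qed.

Lemma lebesgue_rV_box n (A : 'I_n -> set (measurableTypeR R)) :
  (forall i, measurable (A i)) ->
  lam n (rV_box A) = (\prod_(i < n) lebesgue_measure (A i))%E.
Proof.
elim: n A => [|n IHn] A mA.
  by rewrite big_ord0 /= diracE mem_set//; case.
rewrite big_ord_recl /= /lebesgue_rV_succ /pushforward.
rewrite -(IHn (fun i => A (lift ord0 i)))//.
rewrite (_ : _ @^-1` _ = A ord0 `*` rV_box (fun i => A (lift ord0 i))).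
  by rewrite product_measure1E//; apply: measurable_rV_box => i; exact: mA.
apply/seteqP; split=> -[t y] /=.
  move=> tyA; split=> [|i]; first by move: (tyA ord0); rewrite mxE unlift_none.
  by move: (tyA (lift ord0 i)); rewrite mxE liftK.
move=> [At Ay] i; rewrite mxE; case: (unliftP ord0 i) => [j|] -> /=; last exact: At.
exact: Ay.
Qed.

(** Balls of the sup norm are boxes, so their measure is a product of lengths. *)
Lemma lebesgue_rV_ball_gt0 n (x : 'rV[R]_n) (e : R) : 0 < e ->
  (0 < lam n (ball x e))%E.
Proof.
move=> e0; have -> : ball x e = rV_box (fun i => ball (x ord0 i) e).
  apply/seteqP; split=> y /=; first by move=> [_ xy] i; exact: xy.
  by move=> xy; split=> // i j; rewrite (ord1 i); exact: xy.
rewrite lebesgue_rV_box => [|i]; last by apply: open_measurable; exact: ball_open.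
elim/big_ind : _ => [|a b|i _]; [by rewrite lte_fin ltr01|by move=> a0 b0; rewrite mule_gt0|].
by rewrite lebesgue_measure_ball ?lte_fin ?pmulrn_lgt0// ltW.
Qed.

Lemma lebesgue_rV_open_gt0 n (U : set 'rV[R]_n) : open U -> U !=set0 ->
  (0 < lam n U)%E.
Proof.
move=> oU [x Ux]; have /nbhs_ballP[e /= e0 eU] : nbhs x U by exact: open_nbhs_nbhs.
apply: lt_le_trans (lebesgue_rV_ball_gt0 x e0) _.
by apply: le_measure; rewrite ?inE//; apply: open_measurable_rV => //; exact: ball_open.
Qed.

Lemma lebesgue_rV_bounded n (A : set 'rV[R]_n) : measurable A -> bounded_set A ->
  (lam n A < +oo)%E.
Proof.
(* The bound holds for every number above [M], so for [|M| + 1]; one more unit makes the inequality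
   strict, as an open ball requires. *)
move=> mA [M [_ AM]]; pose e := `|M| + 2.
have e0 : 0 < e by rewrite ltr_wpDl.
have AB : A `<=` ball 0 e.
  move=> x Ax; split=> // i j; rewrite (ord1 i) /ball /= mxE sub0r normrN.
  apply: (@le_lt_trans _ _ (`|M| + 1)); last by rewrite ltrD2l ltr1n.
  apply: le_trans (AM (`|M| + 1) _ x Ax).
    rewrite [leRHS]mx_normrE; apply: le_trans (le_bigmax _ _ (ord0, j)) => //=.
  by rewrite (le_lt_trans (ler_norm M))// ltrDl.
have mB : measurable (ball (0 : 'rV[R]_n) e) by apply: open_measurable_rV; exact: ball_open.
apply: (@le_lt_trans _ _ (lam n (ball 0 e))).
  by apply: le_measure; rewrite ?inE.
have -> : ball (0 : 'rV[R]_n) e = rV_box (fun i => ball (0 : R) e).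
  apply/seteqP; split=> y /=; first by move=> [_ xy] i; move: (xy ord0 i); rewrite mxE.
  by move=> xy; split=> // i j; rewrite (ord1 i) mxE; exact: xy.
rewrite lebesgue_rV_box => [|i]; last by apply: open_measurable; exact: ball_open.
suff : (\prod_(i < n) lebesgue_measure (ball (0%R : R) e))%E \is a fin_num.
  by rewrite fin_numElt => /andP[].
elim/big_ind : _ => // [a b|i _]; first exact: fin_numM.
by rewrite lebesgue_measure_ball// ltW.
Qed.

Lemma continuous_integrable_rV n (A : set 'rV[R]_n) (g : 'rV[R]_n -> R) :
  measurable A -> bounded_set A -> continuous g ->
  (lam n).-integrable A (EFin \o g).
Proof.
move=> mA bA cg; apply: measurable_bounded_integrable => //.
- exact: lebesgue_rV_bounded.
- by apply: measurable_funS (continuous_measurable_rV cg).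
have [M [_ AM]] := bA; pose e := `|M| + 1.
have K : compact (closed_ball_ Num.norm (0 : 'rV[R]_n) e).
  apply: bounded_closed_compact.
    exists e; split; first exact: num_real.
    by move=> r er x; rewrite /closed_ball_/= sub0r normrN => /le_trans; apply; exact: ltW.
  by apply: closed_closed_ball_.
have /compact_bounded[N [Nr NP]] : compact (g @` closed_ball_ Num.norm (0 : 'rV[R]_n) e).
  by apply: continuous_compact => //; exact: continuous_subspaceT.
exists N; split=> // r Nr' x Ax; apply: (NP r) => //; exists x => //=.
rewrite /closed_ball_/= sub0r normrN; apply: AM => //.
by rewrite (le_lt_trans (ler_norm M))// ltrDl.
Qed.

Lemma continuous_dot n (p : 'rV[R]_n) : continuous (fun x : 'rV[R]_n => dot p x).
Proof.
move=> x; rewrite /dot.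
apply: (@cvg_big _ _ _ _ _ (@add_continuous R) _ _ _
  (fun i (y : 'rV[R]_n) => p ord0 i * y ord0 i)
  (fun i => p ord0 i * x ord0 i) (nbhs_filter x)) => i _.
by apply: cvgM; [exact: cvg_cst|exact: coord_continuous].
Qed.

Lemma continuous_affine n (p : 'rV[R]_n) (b : R) :
  continuous (fun x : 'rV[R]_n => dot p x + b).
Proof.
by move=> x; apply: (@cvgD _ R^o _ _ _ _ _ _ _ (@continuous_dot n p x)); exact: cvg_cst.
Qed.

Lemma continuous_mulmxr m n (A : 'M[R]_(m, n)) :
  continuous (fun x : 'rV[R]_m => x *m A).
Proof.
move=> x; have fx := nbhs_filter x.
have -> : mulmx^~ A = fun y => \sum_i y ord0 i *: row i A.
  by apply/funext => y; rewrite mulmx_sum_row.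
apply: (@cvg_big _ _ _ _ _ (@add_continuous 'rV[R]_n) _ _ _
  (fun i (y : 'rV[R]_m) => y ord0 i *: row i A)
  (fun i => x ord0 i *: row i A) fx) => i _.
apply: (@cvgZ _ _ _ (nbhs x) fx (fun y : 'rV[R]_m => y ord0 i) (fun=> row i A)).
  exact: coord_continuous.
exact: (@cvg_cst _ _ _ (nbhs x) fx).
Qed.

Lemma continuous_mulmxrD m n (A : 'M[R]_(m, n)) (b : 'rV[R]_n) :
  continuous (fun x : 'rV[R]_m => x *m A + b).
Proof.
move=> x; apply: (@cvgD _ _ _ (nbhs x) (nbhs_filter x) (fun y => y *m A) (fun=> b)).
  exact: continuous_mulmxr.
exact: (@cvg_cst _ _ _ (nbhs x) (nbhs_filter x)).
Qed.

Lemma measurable_affine_zeros n (p : 'rV[R]_n) (b : R) :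
  measurable [set x : 'rV[R]_n | dot p x + b = 0].
Proof.
apply: closed_measurable_rV.
by apply: (closed_comp _ (@closed_eq R 0)) => x _; exact: continuous_affine.
Qed.

(** Induction on [n] by slicing along the first coordinate: each slice is again the zero set of an
    affine function, and it is null unless that function is identically zero, which happens for at
    most one slice. *)
Lemma lebesgue_rV_affine_zeros n (p : 'rV[R]_n) (b : R) :
  p != 0 \/ b != 0 -> lam n [set x | dot p x + b = 0] = 0%E.
Proof.
elim: n p b => [|n IHn] p b pb.
  rewrite /= diracE memNset//= /dot big_ord0 add0r => b0.
  by case: pb; rewrite ?b0 ?eqxx// [p]thinmx0 eqxx.
pose p' : 'rV[R]_n := \row_i p ord0 (lift ord0 i).
rewrite /= /lebesgue_rV_succ /pushforward /product_measure1.
have secE t : xsection (@rV_cons R n @^-1` [set x | dot p x + b = 0]) t =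
    [set y | dot p' y + (p ord0 ord0 * t + b) = 0].
  have E y : dot p (rV_cons (t, y)) + b = dot p' y + (p ord0 ord0 * t + b).
    rewrite /dot big_ord_recl !mxE unlift_none/= -addrA addrCA.
    congr (_ + _); apply: eq_bigr => i _.
    by rewrite !mxE liftK /=.
  by apply/seteqP; split=> y; rewrite /xsection /= inE /= E.
have mx : measurable_fun setT (lam n \o
    xsection (@rV_cons R n @^-1` [set x | dot p x + b = 0])).
  apply: measurable_fun_xsection.
  rewrite -[X in measurable X]setTI; apply: measurable_rV_cons => //.
  exact: measurable_affine_zeros.
rewrite (@ae_eq_integral _ _ _ _ _ (cst 0%E))//; first by rewrite integral0.
(* The exceptional slices, on which the remaining affine function is identically zero and the
   induction hypothesis says nothing. *)
pose N : set (measurableTypeR R) := [set t | p ord0 ord0 * t + b = 0 /\ p' = 0].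
exists [set t | p ord0 ord0 * t + b = 0 /\ p' = 0].
suff [mN N0] : measurable N /\ lebesgue_measure N = 0%E.
  split=> // t /= /not_implyP[_]; rewrite secE => tN.
  apply: contrapT => /not_andP tN'; apply: tN; apply: IHn.
  by case: tN' => /eqP; [right|left].
have [p00|p0] := eqVneq (p ord0 ord0) 0; last first.
  have NS : N `<=` [set - b / p ord0 ord0].
    by move=> t [/eqP + _] /=; rewrite addr_eq0 => /eqP <-; rewrite mulrC mulKf.
  have [p'0|p'0] := eqVneq p' 0.
    have -> : N = [set - b / p ord0 ord0].
      apply/seteqP; split=> // t /= ->; split=> //.
      by rewrite mulrC divfK// addNr.
    by split; [exact: measurable_set1|exact: lebesgue_measure_set1].
  have -> : N = set0 by apply/seteqP; split=> // t [_] /eqP; rewrite (negPf p'0).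
  by split; [exact: measurable0|exact: measure0].
(* With a zero leading coefficient, a point of [N] would give both [p = 0] and [b = 0]. *)
have -> : N = set0; last by split; [exact: measurable0|exact: measure0].
apply/seteqP; split=> // t []; rewrite p00 mul0r add0r => b0 p'0.
case: pb => /eqP; last by [].
apply; apply/rowP => i; rewrite mxE; case: (unliftP ord0 i) => [j|] -> //.
by move/rowP: p'0 => /(_ j); rewrite !mxE.
Qed.

End lebesgue_rV_theory.

(** * Scalar product and Gram determinants *)

Section dot_theory.
Context {R : realType} {d : nat}.
Implicit Types x y z : 'rV[R]_d.

Lemma dotC x y : dot x y = dot y x.
Proof. by apply: eq_bigr => i _; rewrite mulrC. Qed.

Lemma dotDr x y z : dot x (y + z) = dot x y + dot x z.
Proof. by rewrite /dot -big_split; apply: eq_bigr => i _; rewrite mxE mulrDr. Qed.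

Lemma dotZr a x y : dot x (a *: y) = a * dot x y.
Proof. by rewrite /dot mulr_sumr; apply: eq_bigr => i _; rewrite mxE mulrCA. Qed.

Lemma dot0r x : dot x 0 = 0.
Proof. by rewrite -(scale0r 0) dotZr mul0r. Qed.

Lemma dotNr x y : dot x (- y) = - dot x y.
Proof. by rewrite -scaleN1r dotZr mulN1r. Qed.

Lemma dotBr x y z : dot x (y - z) = dot x y - dot x z.
Proof. by rewrite dotDr dotNr. Qed.

Lemma dotDl x y z : dot (x + y) z = dot x z + dot y z.
Proof. by rewrite dotC dotDr !(dotC z). Qed.

Lemma dotZl a x y : dot (a *: x) y = a * dot x y.
Proof. by rewrite dotC dotZr dotC. Qed.

Lemma dot0l x : dot 0 x = 0.
Proof. by rewrite dotC dot0r. Qed.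

Lemma dotNl x y : dot (- x) y = - dot x y.
Proof. by rewrite dotC dotNr dotC. Qed.

Lemma dot_sumr I (r : seq I) (P : pred I) x (F : I -> 'rV[R]_d) :
  dot x (\sum_(i <- r | P i) F i) = \sum_(i <- r | P i) dot x (F i).
Proof.
elim/big_rec2 : _ => [|i u v _ <-]; first exact: dot0r.
by rewrite dotDr.
Qed.

Lemma dotE x y : dot x y = (x *m y^T) ord0 ord0.
Proof. by rewrite mxE; apply: eq_bigr => i _; rewrite mxE. Qed.

Lemma dot_ge0 x : 0 <= dot x x.
Proof. by apply: sumr_ge0 => i _; rewrite -expr2 sqr_ge0. Qed.

Lemma dot_eq0 x : (dot x x == 0) = (x == 0).
Proof.
apply/eqP/eqP => [x0|->]; last exact: dot0r.
apply/rowP => i; rewrite mxE; apply/eqP; rewrite -sqrf_eq0 expr2; apply/eqP.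
by apply: (psumr_eq0P _ x0) => // j _; rewrite -expr2 sqr_ge0.
Qed.

Lemma dot_eq0P x : (forall y, dot x y = 0) -> x = 0.
Proof. by move=> x0; apply/eqP; rewrite -dot_eq0 x0. Qed.

(** A matrix with more rows than columns has a nonzero left kernel. *)
Lemma exists_orthogonal (s : seq 'rV[R]_d) : (size s < d)%N ->
  exists2 p, p != 0 & forall x, x \in s -> dot p x = 0.
Proof.
move=> sd; pose M : 'M[R]_(d, size s) := \matrix_(i, j) s`_j ord0 i.
have : kermx M != 0.
  rewrite -mxrank_eq0 mxrank_ker subn_eq0 -ltnNge.
  by rewrite (leq_ltn_trans _ sd)// rank_leq_col.
move=> /rowV0Pn[p /sub_kermxP pM p0]; exists p => // x xs.
have xi : (index x s < size s)%N by rewrite index_mem.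
have /rowP/(_ (Ordinal xi)) := pM; rewrite !mxE => <-.
by apply: eq_bigr => i _; rewrite mxE /= nth_index.
Qed.

End dot_theory.


(* The determinant of [(1 - t) I + t E E^T] does not vanish for [t] in [0, 1] and
   is [1] for [t = 0]. *)
Lemma gram_det_gt0 {R : realType} m n (E : 'M[R]_(m, n)) :
  row_free E -> 0 < \det (E *m E^T).
Proof.
move=> fE; pose G := E *m E^T.
pose P : 'M[{poly R}]_m := map_mx polyC 1%:M + 'X *: map_mx polyC (G - 1%:M).
have PE t : (\det P).[t] = \det (1%:M + t *: (G - 1%:M)).
  rewrite -[LHS]/(horner_eval t (\det P)) -det_map_mx; congr determinant.
  by apply/matrixP => i j; rewrite !mxE -[LHS]/(horner _ t) !hornerE.
have sq (k : nat) (x : 'rV[R]_k) : x != 0 -> 0 < (x *m x^T) ord0 ord0.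
  by move=> x0; rewrite -dotE lt_neqAle dot_ge0 eq_sym dot_eq0 andbT.
have P0 t : 0 <= t <= 1 -> (\det P).[t] != 0.
  move=> /andP[t0 t1]; rewrite PE; apply/det0P => -[v v0 /(congr1 (mulmx^~ v^T))].
  rewrite mul0mx => /matrixP/(_ ord0 ord0); rewrite [RHS]mxE => vG.
  (* Pairing the kernel relation with [v] gives [(1 - t) |v|^2 + t |v E|^2 = 0], which is impossible
     once both squares are positive. *)
  have vE : v *m E != 0.
    by apply: contra_neq v0 => vE; apply: (row_free_inj fE); rewrite vE mul0mx.
  have := sq _ _ v0; have := sq _ _ vE; move: vG.
  rewrite mulmxDr mulmxDl mulmx1 -scalemxAr -scalemxAl mulmxBr mulmxBl mulmx1.
  rewrite trmx_mul !mulmxA !mxE; nra.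
rewrite ltNge; apply/negP => detG.
(* The sign is changed because [poly_ivt] expects a nonpositive value at [0] and a nonnegative one
   at [1]; here they are [-1] and [- \det G]. *)
have [|x xI] := @poly_ivt R (- \det P) 0 1 ler01.
  by rewrite !hornerN !PE scale0r addr0 scale1r addrC subrK det1 oppr_le0 ler01 /= oppr_ge0.

by rewrite rootE hornerN oppr_eq0 (negPf (P0 _ xI)).
Qed.

(** * Barycentric coordinates *)

Section simplex.
Context {R : realType} {d : nat} {T : mesh R d}.
Implicit Types (S F : {set 'I_(nvert T)}).
Local Notation index := 'I_(nvert T).

Lemma affine_line (u x y : 'rV[R]_d) (a t : R) :
  dot u (x + t *: (y - x)) + a = (1 - t) * (dot u x + a) + t * (dot u y + a).
Proof. by rewrite dotDr dotZr dotBr; ring. Qed.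

Lemma affine_comb S (w : index -> R) (p : 'rV[R]_d) (q : R) :
  \sum_(j in S) w j = 1 ->
  dot p (\sum_(j in S) w j *: vert j) + q =
  \sum_(j in S) w j * (dot p (vert j) + q).
Proof.
move=> w1; rewrite dot_sumr; under eq_bigr do rewrite dotZr.
under [RHS]eq_bigr do rewrite mulrDr.
by rewrite big_split/= -mulr_suml w1 mul1r.
Qed.

(** The barycentric coordinate of the vertex [j] is stored as its gradient [p j] and its constant
    term [q j]. The first two identities are required on the whole space, so that the coordinates
    also apply to points outside the simplex. *)
Definition barycentric S (p : index -> 'rV[R]_d) (q : index -> R) : Prop :=
  [/\ forall x, \sum_(j in S) (dot (p j) x + q j) = 1,
      forall x, \sum_(j in S) (dot (p j) x + q j) *: vert j = x &
      forall i j, i \in S -> j \in S -> dot (p j) (vert i) + q j = (i == j)%:R].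

(** Affine independence makes the matrix with rows [(vert j, 1)] invertible; the column of its
    inverse attached to [j] lists the entries of [p j], then [q j]. *)
Lemma barycentric_exists S : #|S| = d.+1 -> affinely_independent S ->
  exists p q, barycentric S p q.
Proof.
move=> cS aS.
have [j0 j0S] : exists j, j \in S by apply/set0Pn; rewrite -card_gt0 cS.
pose e (k : 'I_#|S|) : index := enum_val k.
pose M : 'M[R]_(#|S|, d + 1) := \matrix_k row_mx (vert (e k)) 1%:M.
have rM (w : 'rV[R]_#|S|) : w *m M =
    row_mx (\sum_k w ord0 k *: vert (e k)) (\sum_k w ord0 k)%:M.
  rewrite mulmx_sum_row; under eq_bigr do rewrite rowK scale_row_mx.
  apply/rowP => i; rewrite summxE; case: (splitP i) => k ik.
    have -> : i = lshift 1 k by apply: val_inj.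
    rewrite row_mxEl summxE; apply: eq_bigr => l _.
    by rewrite row_mxEl.
  have -> : i = rshift d k by apply: val_inj.
  rewrite row_mxEr (ord1 k) mxE eqxx mulr1n; apply: eq_bigr => l _.
  by rewrite row_mxEr !mxE mulr1.
have fM : row_free M.
  apply/row_freeP; apply/row_freeP; rewrite -kermx_eq0.
  apply/rowV0P => w /sub_kermxP; rewrite rM => /eqP; rewrite row_mx_eq0.
  move=> /andP[/eqP w0 /eqP/matrixP/(_ ord0 ord0)].
  rewrite !mxE eqxx mulr1n => w1.
  apply/rowP => k; rewrite mxE.
  have wE (k' : 'I_#|S|) : w ord0 (enum_rank_in j0S (e k')) = w ord0 k'.
    by rewrite enum_valK_in.
  rewrite -wE; apply: (aS (fun j => w ord0 (enum_rank_in j0S j))).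
  - by rewrite big_enum_val/= -[RHS]w1; apply: eq_bigr => i _; exact: wE.
  - by rewrite big_enum_val/= -[RHS]w0; apply: eq_bigr => i _; rewrite wE.
  - exact: enum_valP.
(* The two dimensions of [M] are equal only by hypothesis, so the two inverse identities are derived
   one after the other. *)
have /row_fullP[N NM] : row_full M by rewrite /row_full (eqP fM) cS addn1.
have MN : M *m N = 1%:M.
  by apply: (row_free_inj fM); rewrite -mulmxA NM mulmx1 mul1mx.
pose p j : 'rV[R]_d := \row_i N (lshift 1 i) (enum_rank_in j0S j).
pose q j : R := N (rshift d ord0) (enum_rank_in j0S j).
have pqE x j : dot (p j) x + q j = (row_mx x 1%:M *m N) ord0 (enum_rank_in j0S j).
  rewrite mxE big_split_ord/= big_ord1 row_mxEr mxE eqxx mul1r; congr (_ + _).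
  by apply: eq_bigr => i _; rewrite row_mxEl mxE mulrC.
have xNM x := rM (row_mx x 1%:M *m N).
have {}xNM x : row_mx x 1%:M = row_mx (\sum_k (row_mx x 1%:M *m N) ord0 k *: vert (e k))
    (\sum_k (row_mx x 1%:M *m N) ord0 k)%:M.
  by rewrite -xNM -mulmxA NM mulmx1.
exists p, q; split=> [x|x|i j iS jS].
- have /eq_row_mx[_ /matrixP/(_ ord0 ord0)] := xNM x.
  rewrite !mxE eqxx mulr1n => x1; rewrite big_enum_val [RHS]x1; apply: eq_bigr => k _.
  by rewrite pqE enum_valK_in.
- have /eq_row_mx[xE _] := xNM x.
  rewrite big_enum_val [RHS]xE; apply: eq_bigr => k _.
  by rewrite pqE enum_valK_in.
- rewrite pqE.
  have -> : row_mx (vert i) 1%:M = row (enum_rank_in j0S i) M.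
    by rewrite rowK /e enum_rankK_in.
  rewrite -row_mul MN !mxE; congr (_%:R).
  by rewrite (can_in_eq (enum_rankK_in j0S)).
Qed.

Section faces.
Variables (S : {set index}) (p : index -> 'rV[R]_d) (q : index -> R).
Hypothesis pqS : barycentric S p q.

Lemma barycentric_sum (w : index -> R) : \sum_(j in S) w j = 1 ->
  forall j, j \in S -> dot (p j) (\sum_(i in S) w i *: vert i) + q j = w j.
Proof.
case: pqS => _ _ pq w1 j jS; rewrite affine_comb// (bigD1 j)//= pq// eqxx mulr1.
rewrite big1 ?addr0// => i /andP[iS ij].
by rewrite pq// (negPf ij) mulr0.
Qed.

Lemma hull_barycentric : hull S = [set x | forall j, j \in S -> 0 <= dot (p j) x + q j].
Proof.
apply/seteqP; split=> [x [w [w0 w1 ->]] j jS|x x0].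
  by rewrite barycentric_sum.
exists (fun j => if j \in S then dot (p j) x + q j else 0).
case: pqS => s1 sx _; split.
- by move=> j; case: ifPn => // jS; exact: x0.
- by rewrite -[RHS](s1 x); apply: eq_bigr => j ->.
- by rewrite -[LHS](sx x); apply: eq_bigr => j ->.
Qed.

Lemma hull_face F x : F \subset S -> hull F x ->
  forall j, j \in S -> j \notin F -> dot (p j) x + q j = 0.
Proof.
move=> FS [w [w0 w1 ->]] j jS jF.
have FSE (V : nmodType) (g : index -> V) :
    \sum_(i in S) (if i \in F then g i else 0) = \sum_(i in F) g i.
  by rewrite -big_mkcondr; apply: eq_bigl => i; rewrite andb_idl// => /(fintype.subsetP FS).
have -> : \sum_(i in F) w i *: vert i =
    \sum_(i in S) (if i \in F then w i else 0) *: vert i.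
  rewrite -FSE; apply: eq_bigr => i _.
  by case: ifP => //; rewrite scale0r.
by rewrite barycentric_sum ?FSE// (negPf jF).
Qed.

Lemma vert_inj_in i j : i \in S -> j \in S -> vert i = vert j -> i = j.
Proof.
case: pqS => _ _ pq iS jS ij; apply/eqP.
have := pq i i iS iS; rewrite ij pq// eqxx eq_sym => /eqP.
by case: (i == j) => //; rewrite eq_sym oner_eq0.
Qed.

Lemma hull_closed : closed (hull S).
Proof.
rewrite hull_barycentric.
have -> : [set x | forall j, j \in S -> 0 <= dot (p j) x + q j] =
    \bigcap_(j in [set j | j \in S]) [set x | 0 <= dot (p j) x + q j] by [].
apply: closed_bigI => j _.
by apply: (closed_comp _ (@closed_ge R 0)) => x _; exact: continuous_affine.
Qed.

(** The points with all coordinates positive form an open subset of the simplex, and a small move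
    from [z] towards the barycenter enters it without leaving [U]. *)
Lemma hull_open_near z (U : set 'rV[R]_d) : hull S z -> nbhs z U ->
  exists V, [/\ open V, V !=set0, V `<=` U & V `<=` hull S].
Proof.
move=> Sz Uz.
pose P := [set x | forall j, j \in S -> 0 < dot (p j) x + q j].
have oP : open P.
  rewrite openE => x Px.
  apply: (@filter_forall _ _ (fun j y => j \in S -> 0 < dot (p j) y + q j) (nbhs x)) => j.
  have [jS|_] := boolP (j \in S); last exact: filterE.
  have /continuousP/(_ _ (@open_gt R 0)) oj := @continuous_affine R d (p j) (q j).
  have xj : nbhs x [set y | 0 < dot (p j) y + q j].
    by apply: open_nbhs_nbhs; split=> //; exact: Px.
  by apply: filterS xj.
exists (U° `&` P); split.
- by apply: openI => //; exact: open_interior.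
- pose b := \sum_(j in S) #|S|%:R^-1 *: vert j : 'rV[R]_d.
  have [S0|Sn0] := eqVneq #|S| 0%N.
    have [s1 _ _] := pqS; have := s1 0; rewrite big_pred0 => [/eqP|j].
      by rewrite eq_sym oner_eq0.
    by move: S0 => /eqP; rewrite cards_eq0 => /eqP ->; rewrite inE.
  have cv : (fun t : R => z + t *: (b - z)) @ 0^'+ --> z.
    rewrite -[X in _ --> X]addr0 -(scale0r (b - z)).
    apply: cvgD; first exact: cvg_cst.
    by apply: cvgZ; [exact: cvg_within|exact: cvg_cst].
  have Uz' : \forall t \near 0^'+, U° (z + t *: (b - z)).
    by apply: (cv U°); exact: nbhs_interior.
  have [t [[Ut t1] t0]] := filter_ex (filterI (filterI Uz' (nbhs_right_lt (@ltr01 R)))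
    (nbhs_right_gt (0 : R))).
  exists (z + t *: (b - z)); split => // j jS.
  have zj : 0 <= dot (p j) z + q j by move: Sz; rewrite hull_barycentric; exact.
  have bj : dot (p j) b + q j = #|S|%:R^-1.
    rewrite barycentric_sum//.
    by rewrite sumr_const -[_ *+ _]mulr_natr mulVf// pnatr_eq0.
  have bj0 : 0 < dot (p j) b + q j by rewrite bj invr_gt0 ltr0n lt0n.
  rewrite affine_line; nra.
- by move=> x [/interior_subset].
- by move=> x [_ Px]; rewrite hull_barycentric => j /Px /ltW.
Qed.

Lemma eq_affine_on_simplex (u v : 'rV[R]_d) (a b : R) :
  (forall j, j \in S -> dot u (vert j) + a = dot v (vert j) + b) ->
  forall x, dot u x + a = dot v x + b.
Proof.
case: pqS => s1 sx _ uv x; rewrite -(sx x) !affine_comb//.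
by apply: eq_bigr => j jS; rewrite uv.
Qed.

End faces.

(** Two simplices lying on the same side of a common facet overlap: starting at the barycenter [m]
    of the facet, a small move towards the opposite vertex of [S'] stays in [S'] and also enters
    [S], away from the facet. *)
Lemma simplices_not_same_side S S' p q p' q' (n : 'rV[R]_d) (a : R) :
  barycentric S p q -> barycentric S' p' q' ->
  #|S| = d.+1 -> #|S'| = d.+1 -> #|S :&: S'| = d -> (0 < d)%N ->
  hull S `&` hull S' = hull (S :&: S') -> n != 0 ->
  (forall j, j \in S :&: S' -> dot n (vert j) + a = 0) ->
  (forall j, j \in S -> dot n (vert j) + a <= 0) ->
  (forall j, j \in S' -> dot n (vert j) + a <= 0) -> False.
Proof.
move=> pqS pqS' cS cS' cF d0 hSS' n0 nF nS nS'; set F := S :&: S' in cF hSS' nF.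
have [k kS kF] : exists2 k, k \in S & k \notin F.
  by apply/subsetPn; apply/negP => /subset_leq_card; rewrite cS cF ltnn.
have [k' kS' kF'] : exists2 k', k' \in S' & k' \notin F.
  by apply/subsetPn; apply/negP => /subset_leq_card; rewrite cS' cF ltnn.
have SE : S = k |: F.
  apply/esym/eqP; rewrite eqEcard cS cardsU1 kF cF add1n leqnn andbT.
  by rewrite finset.subUset finset.sub1set kS finset.subsetIl.
have SE' : S' = k' |: F.
  apply/esym/eqP; rewrite eqEcard cS' cardsU1 kF' cF add1n leqnn andbT.
  by rewrite finset.subUset finset.sub1set kS' finset.subsetIr.
(* If the affine function also vanished at the opposite vertex, it would vanish at all vertices,
   hence everywhere, and [n] would be zero. *)
have neg (S0 : {set index}) p0 q0 k0 : barycentric S0 p0 q0 -> S0 = k0 |: F ->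
    dot n (vert k0) + a <= 0 -> dot n (vert k0) + a < 0.
  move=> pq0 S0E; rewrite le_eqVlt => /predU1P[k00|//].
  have nx x : dot n x + a = 0.
    rewrite (eq_affine_on_simplex pq0 (v := 0) (b := 0)) ?dot0l ?addr0// => j.
    by rewrite dot0l addr0 S0E !inE => /predU1P[->|jF]//; rewrite nF ?inE.
  move/eqP: n0; case; apply: dot_eq0P => x.
  by have := nx x; have := nx 0; rewrite dot0r add0r => ->; rewrite addr0.
have s0 := neg _ _ _ _ pqS SE (nS _ kS).
have s0' := neg _ _ _ _ pqS' SE' (nS' _ kS').
set s := dot n (vert k) + a in s0; set s' := dot n (vert k') + a in s0'.
(* The affine function is [s] times the coordinate of [k]; at [vert k'] its value is [s'], which has
   the sign of [s]. *)
have bk : 0 < dot (p k) (vert k') + q k.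
  have E x : dot n x + a = s * (dot (p k) x + q k).
    rewrite mulrDr -dotZl; apply: (eq_affine_on_simplex pqS) => j jS.
    rewrite dotZl -mulrDr; case: pqS => _ _ ->//.
    have [->|jk] := eqVneq j k; first by rewrite mulr1.
    by rewrite mulr0 nF//; move: jS; rewrite SE !inE (negPf jk).
  by have := E (vert k'); rewrite -/s'; nra.
pose m := \sum_(j in F) d%:R^-1 *: vert j : 'rV[R]_d.
have dR : d%:R != 0 :> R by rewrite pnatr_eq0 -lt0n.
have d0R : 0 < d%:R :> R by rewrite ltr0n.
have m1 : \sum_(j in F) (d%:R^-1 : R) = 1.
  by rewrite sumr_const cF -[_ *+ _]mulr_natr mulVf.
have Fm : hull F m.
  by exists (fun=> d%:R^-1); split=> // _; rewrite invr_ge0 ler0n.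
have FS : F \subset S by exact: finset.subsetIl.
have FS' : F \subset S' by exact: finset.subsetIr.
have mF j : j \in F -> dot (p j) m + q j = d%:R^-1.
  move=> jF; rewrite affine_comb// (bigD1 j)//= big1 => [|i /andP[iF ij]].
    by case: pqS => _ _ ->; rewrite ?(fintype.subsetP FS)// eqxx mulr1 addr0.
  by case: pqS => _ _ ->; rewrite ?(fintype.subsetP FS)// (negPf ij) mulr0.
pose B := \sum_j `|dot (p j) (vert k') + q j|.
have B0 : 0 <= B by apply: sumr_ge0.
have Bj j : `|dot (p j) (vert k') + q j| <= B.
  by rewrite /B (bigD1 j)//= lerDl sumr_ge0.
(* Chosen so that [1 - e = d e B]: for [j] in [F] the coordinate at [y] is [(1 - e) / d + e c] with
   [|c| <= B], hence nonnegative. *)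
pose e := (1 + d%:R * B)^-1.
have den : 0 < 1 + d%:R * B by rewrite ltr_wpDr// mulr_ge0// ltW.
have e0 : 0 < e by rewrite invr_gt0.
have e1 : e <= 1 by rewrite invf_le1// lerDl mulr_ge0// ltW.
have eB : e * (1 + d%:R * B) = 1 by rewrite mulVf// gt_eqF.
pose y := m + e *: (vert k' - m).
have S'y : hull S' y.
  rewrite (hull_barycentric pqS') => j jS'; rewrite affine_line.
  have mj : 0 <= dot (p' j) m + q' j.
    have : hull S' m.
      rewrite (hull_barycentric pqS') => i iS'.
      rewrite affine_comb//; apply: sumr_ge0 => l lF.
      case: pqS' => _ _ ->//; last exact: (fintype.subsetP FS').
    by rewrite (hull_barycentric pqS'); exact.
  case: pqS' => _ _ ->//; rewrite addr_ge0// mulr_ge0 ?ler0n ?subr_ge0//; exact: ltW.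
have Sy : hull S y.
  rewrite (hull_barycentric pqS) => j; rewrite affine_line.
  rewrite SE !inE => /predU1P[->|jF].
    rewrite (hull_face pqS FS Fm kS kF) mulr0 add0r.
    by rewrite mulr_ge0// ltW.
  rewrite mF ?inE//.
  have := Bj j; rewrite ler_norml => /andP[Bj' _].
  rewrite -(pmulr_rge0 _ d0R) mulrDr mulrCA divff// mulr1.
  have : 0 <= d%:R * e * (B + (dot (p j) (vert k') + q j)).
    by rewrite mulr_ge0// ?mulr_ge0 ?(ltW d0R) ?(ltW e0)// -lerBlDl sub0r.
  nra.
(* As [y] is in both simplices, matching places it in the facet, although its coordinate for [k] is
   positive. *)
have : hull F y by rewrite -hSS'.
move/(hull_face pqS FS) => /(_ k kS kF); rewrite affine_line.
rewrite (hull_face pqS FS Fm kS kF) mulr0 add0r => /eqP.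
by rewrite mulf_eq0 !gt_eqF.
Qed.

End simplex.

(** * Connectivity of the mesh through its facets *)

(** If [A] and [B] did not meet inside [D], the part of [D] in [A] would be closed and open in [D],
    hence all of [D]. *)
Lemma connected_closed_cover (X : topologicalType) (D A B : set X) :
  connected D -> closed A -> closed B -> D `<=` A `|` B ->
  D `&` A !=set0 -> D `&` B !=set0 -> D `&` (A `&` B) !=set0.
Proof.
move=> cD cA cB DAB DA [y [Dy By]]; apply: contrapT => AB0.
have DAE : D `&` A = D.
  apply: cD => //; last by exists A.
  exists (~` B); first exact: closed_openC.
  apply/seteqP; split=> x [Dx] => [Ax|Bx]; split=> //.
    by move=> Bx; apply: AB0; exists x.
  by case: (DAB _ Dx).
have : (D `&` A) y by rewrite DAE.
by move=> [_ Ay]; apply: AB0; exists y.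
Qed.

(** * Generic points and segments *)

Section avoid.
Context {R : realType} {d : nat}.

(** Hyperplanes are closed null sets and nonempty open sets are not null, so the hyperplanes can be
    removed one at a time. *)
Lemma open_avoid_hyperplanes (s : seq ('rV[R]_d * R)) (V : set 'rV[R]_d) :
  (forall h, h \in s -> h.1 != 0) -> open V -> V !=set0 ->
  exists2 x, V x & forall h, h \in s -> dot h.1 x != h.2.
Proof.
elim: s V => [|h s IHs] V s0 oV V0; first by case: V0 => x Vx; exists x.
pose H := [set x : 'rV[R]_d | dot h.1 x - h.2 = 0].
have h0 : h.1 != 0 by apply: s0; rewrite mem_head.
have cH : closed H.
  by apply: (closed_comp _ (@closed_eq R 0)) => x _; exact: continuous_affine.
have [|||x [Vx Hx] xs] := IHs (V `&` ~` H).
- by move=> k ks; apply: s0; rewrite in_cons ks orbT.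
- by apply: openI => //; exact: closed_openC.
- apply: contrapT => VH0.
  have VH : V `<=` H.
    by move=> x Vx; apply: contrapT => Hx; apply: VH0; exists x.
  have := lebesgue_rV_open_gt0 oV V0; rewrite ltNge => /negP; apply.
  rewrite -(@lebesgue_rV_affine_zeros R d h.1 (- h.2)); last by left.
  apply: le_measure => //; rewrite inE; first exact: open_measurable_rV.
  exact: measurable_affine_zeros.
exists x => // k; rewrite in_cons => /predU1P[->|/xs//].
by rewrite -subr_eq0; apply/eqP.
Qed.

Lemma ball_segment (z x y : 'rV[R]_d) (e t : R) : 0 <= t <= 1 ->
  ball z e x -> ball z e y -> ball z e (x + t *: (y - x)).
Proof.
move=> /andP[t0 t1]; rewrite -ball_normE /= => zx zy.
have -> : z - (x + t *: (y - x)) = (1 - t) *: (z - x) + t *: (z - y).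
  by rewrite scalerBl scale1r !scalerBr; apply/rowP => i; rewrite !mxE; ring.
apply: le_lt_trans (ler_normD _ _) _.
rewrite !normrZ (ger0_norm t0) ger0_norm ?subr_ge0//.
apply: (@le_lt_trans _ _ (Num.max `|z - x| `|z - y|)); last by rewrite gt_max zx.
have xm : `|z - x| <= Num.max `|z - x| `|z - y| by rewrite le_max lexx.
have ym : `|z - y| <= Num.max `|z - x| `|z - y| by rewrite le_max lexx orbT.
nra.
Qed.

End avoid.

Section mesh_connectivity.
Context {R : realType} {d : nat} {T : mesh R d}.

Lemma hull_hyperplane (I : {set 'I_(nvert T)}) (u : 'rV[R]_d) (a : R) :
  (forall i, i \in I -> dot u (vert i) = a) -> hull I `<=` [set x | dot u x = a].
Proof.
move=> ua x [w [w0 w1 ->]] /=; rewrite dot_sumr.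
under eq_bigr => i iI do rewrite dotZr ua//.
by rewrite -mulr_suml w1 mul1r.
Qed.

(** The at most [d - 1] differences [vert i - x] have a common orthogonal vector. A ray from [x]
    that leaves this hyperplane cannot meet the hull of [I] after its origin. *)
Lemma hyperplane_through (I : {set 'I_(nvert T)}) (x : 'rV[R]_d) : (#|I| < d)%N ->
  exists2 u, u != 0 & forall i, i \in I -> dot u (vert i) = dot u x.
Proof.
move=> Id; have [|u u0 uI] := @exists_orthogonal R d [seq vert i - x | i <- enum I].
  by rewrite size_map -cardE.
exists u => // i iI; apply/eqP; rewrite -subr_eq0 -dotBr; apply/eqP/uI.
by apply: map_f; rewrite mem_enum.
Qed.

(* Cells of [K] and of its complement that meet inside Omega can be joined by a
   segment avoiding the faces of codimension at least 2. *)
Lemma cells_facet_connected (Omega : set 'rV[R]_d) (K : {set 'I_(ncell T)}) :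
  open Omega -> connected Omega -> matching_mesh_of T Omega ->
  K != finset.set0 -> ~: K != finset.set0 ->
  exists c c', [/\ c \in K, c' \notin K & #|cell c :&: cell c'| = d].
Proof.
move=> oO cO [injc cells matching cover] /set0Pn[c0 c0K] /set0Pn[c1].
rewrite finset.inE => c1K; apply: contrapT => nofacet.
(* A common facet is excluded by assumption, and sharing all [d + 1] vertices would identify the
   cells, by injectivity of [cell]. *)
have cardI c c' : c \in K -> c' \notin K -> (#|cell c :&: cell c'| < d)%N.
  move=> cK c'K; rewrite ltn_neqAle; apply/andP; split.
    by apply/eqP => ccd; apply: nofacet; exists c, c'.
  rewrite -ltnS -(cells c).1 ltn_neqAle subset_leq_card ?finset.subsetIl// andbT.
  apply/eqP => ccd; have /eqP ccE : cell c :&: cell c' == cell c.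
    by rewrite eqEcard finset.subsetIl ccd /=.
  have /eqP ccE' : cell c :&: cell c' == cell c'.
    by rewrite eqEcard finset.subsetIr ccd (cells c).1 (cells c').1 /=.
  by move: c'K; rewrite -(injc c c') ?cK// -ccE.
have bary (c : 'I_(ncell T)) : exists p q, barycentric (cell c) p q.
  by apply: barycentric_exists; have [] := cells c.
pose A := \bigcup_(c in [set c | c \in K]) hull (cell c).
pose B := \bigcup_(c in [set c | c \notin K]) hull (cell c).
have clos (P : set 'I_(ncell T)) : closed (\bigcup_(c in P) hull (cell c)).
  apply: closed_bigcup => [|c _]; first exact: finite_finset.
  by have [p [q pq]] := bary c; exact: hull_closed pq.
have OAB : Omega `<=` A `|` B.
  move=> x /subset_closure; rewrite cover => -[c _ cx].
  by have [cK|cK] := boolP (c \in K); [left|right]; exists c.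
(* A cell contains a nonempty open set included in the closure of [Omega], and such an open set
   meets [Omega] itself. *)
have meetO (c : 'I_(ncell T)) : Omega `&` hull (cell c) !=set0.
  have [p [q pq]] := bary c.
  have [j jc] : exists j, j \in cell c.
    by apply/set0Pn; rewrite -card_gt0 (cells c).1.
  have hj : hull (cell c) (vert j).
    by rewrite (hull_barycentric pq) => i ic; case: pq => _ _ ->.
  have [V [oV [x Vx] _ Vc]] := hull_open_near pq hj (filterT : nbhs _ setT).
  have Ox : closure Omega x by rewrite cover; exists c => //; exact: Vc.
  have [y [Oy Vy]] := Ox V (open_nbhs_nbhs (conj oV Vx)).
  by exists y; split=> //; exact: Vc.
have [z [Oz [[c /= cK cz] [c' /= c'K c'z]]]] : Omega `&` (A `&` B) !=set0.
  apply: connected_closed_cover => //; [exact: clos|exact: clos| |].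
    by have [x [Ox cx]] := meetO c0; exists x; split=> //; exists c0.
  by have [x [Ox cx]] := meetO c1; exists x; split=> //; exists c1.
have /nbhs_ballP[e /= e0 zeO] : nbhs z Omega by exact: open_nbhs_nbhs.
have ze : nbhs z (ball z e) by exact: nbhsx_ballx.
have [p [q pq]] := bary c; have [p' [q' pq']] := bary c'.
have [V [oV V0 Vze Vc]] := hull_open_near pq cz ze.
have [W [oW W0 Wze Wc']] := hull_open_near pq' c'z ze.
(* For any base point [x], finitely many hyperplanes through [x] contain all the intersections of a
   cell of [K] with a cell outside [K]. *)
have planes (x : 'rV[R]_d) : exists s : seq ('rV[R]_d * R),
    (forall h, h \in s -> h.1 != 0 /\ h.2 = dot h.1 x) /\
    forall c c', c \in K -> c' \notin K -> exists2 h, h \in s &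
      forall y, hull (cell c) y -> hull (cell c') y -> dot h.1 y = h.2.
  have /choice[u uP] (cc : 'I_(ncell T) * 'I_(ncell T)) : exists u,
      cc.1 \in K -> cc.2 \notin K -> u != 0 /\
      forall i, i \in cell cc.1 :&: cell cc.2 -> dot u (vert i) = dot u x.
    have [cK1|] := boolP (cc.1 \in K); last by exists 0.
    have [|cK2] := boolP (cc.2 \in K); first by exists 0.
    by have [u u0 uI] := hyperplane_through x (cardI _ _ cK1 cK2); exists u.
  exists [seq (u cc, dot (u cc) x) | cc <- enum [set cc | (cc.1 \in K) && (cc.2 \notin K)]%SET].
  split=> [h /mapP[cc]|c2 c2' c2K c2K'].
    by rewrite mem_enum finset.inE => /andP[k1 k2] ->; have [] := uP _ k1 k2.
  exists (u (c2, c2'), dot (u (c2, c2')) x).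
    by apply: (map_f (fun cc => (u cc, dot (u cc) x))); rewrite mem_enum finset.inE c2K.
  move=> y y1 y2; have [_ uI] := uP (c2, c2') c2K c2K'.
  by apply: (hull_hyperplane uI); rewrite -matching.
(* The base point [0] is arbitrary: this list serves to choose [x] outside all the intersections. *)
have [s [s0 sP]] := planes 0.
have [|x Vx xs] := @open_avoid_hyperplanes R d s V _ oV V0; first by move=> h /s0[].
(* The new hyperplanes pass through [x]; with [y] outside them, the segment from [x] to [y] meets
   them at [x] only. *)
have [s' [s0' sP']] := planes x.
have [|y Wy ys] := @open_avoid_hyperplanes R d s' W _ oW W0; first by move=> h /s0'[].
pose g (t : R) := x + t *: (y - x).
have cg : continuous g.
  move=> t; apply: cvgD; first exact: cvg_cst.
  by apply: cvgZ; [exact: cvg_id|exact: cvg_cst].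
have closg (C : set 'rV[R]_d) : closed C -> closed (g @^-1` C).
  by move=> cC; apply: closed_comp => // t _; exact: cg.
have [||||||t /= [t01 [[c2 /= c2K c2g] [c2' /= c2K' c2g']]]] :=
    @connected_closed_cover R `[0, 1] (g @^-1` A) (g @^-1` B).
- exact: segment_connected.
- by apply: closg; exact: clos.
- by apply: closg; exact: clos.
- move=> t /=; rewrite in_itv/= => t01; apply: OAB; apply: zeO.
  by apply: ball_segment => //; [exact: Vze|exact: Wze].
- exists 0; split; first by rewrite /= in_itv/= lexx ler01.
  by exists c => //; rewrite /g scale0r addr0; exact: Vc.
- exists 1; split; first by rewrite /= in_itv/= lexx ler01.
  by exists c' => //; rewrite /g scale1r addrC subrK; exact: Wc'.
(* The segment has a point common to a cell of [K] and a cell outside [K]. The choice of [x]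
   excludes the origin [t = 0], the choice of [y] all other points. *)
have [t0|t0] := eqVneq t 0.
  move: c2g c2g'; rewrite /g t0 scale0r addr0 => xc2 xc2'.
  have [h hs hx] := sP _ _ c2K c2K'.
  by have := xs _ hs; rewrite hx// eqxx.
have [h hs hx] := sP' _ _ c2K c2K'.
have := hx _ c2g c2g'; have [_ h2] := s0' _ hs.
rewrite /g dotDr dotZr dotBr h2 => /eqP; rewrite -subr_eq0 addrC addKr.
rewrite mulf_eq0 (negPf t0) /= subr_eq0 -h2.
by rewrite (negPf (ys _ hs)).
Qed.

End mesh_connectivity.

(** * Facets and rigid displacements *)

Section facets.
Context {R : realType} {d : nat} {T : mesh R d}.
Implicit Types (F : {set 'I_(nvert T)}).

Lemma hull_bounded (S : {set 'I_(nvert T)}) :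
  exists B, forall x, hull S x -> `|x| <= B.
Proof.
exists (\sum_(j in S) `|vert j|) => x [w [w0 w1 ->]].
apply: le_trans (ler_norm_sum _ _ _) _; apply: ler_sum => j jS.
rewrite normrZ ger0_norm// ler_piMl// -w1 (bigD1 j)//= lerDl.
by apply: sumr_ge0.
Qed.

Lemma vert_in_hull F j : j \in F -> hull F (vert j).
Proof.
move=> jF; exists (fun i => (i == j)%:R); split=> // [|]; rewrite (bigD1 j)//= eqxx.
  by rewrite big1 ?addr0// => i /andP[_ /negPf ->].
by rewrite scale1r big1 ?addr0// => i /andP[_ /negPf ->]; rewrite scale0r.
Qed.

Lemma diameter_gt0 F i j : i \in F -> j \in F -> vert i != vert j :> 'rV[R]_d ->
  0 < diameter F.
Proof.
move=> iF jF ij.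
(* The supremum dominates its elements only for a set bounded above; the bound on the hull provides
   this, coordinate by coordinate. *)
have [B Bh] := hull_bounded F.
apply: (@lt_le_trans _ _ (enorm (vert i - vert j))).
  by rewrite sqrtr_gt0 lt_neqAle dot_ge0 eq_sym dot_eq0 subr_eq0 ij.
apply: ub_le_sup; last by exists (vert i), (vert j); split=> //; exact: vert_in_hull.
exists (Num.sqrt (\sum_(k < d) (B + B) ^+ 2)) => _ [x [y [Fx Fy ->]]].
rewrite ler_wsqrtr// /dot; apply: ler_sum => k _.
rewrite -expr2 -real_normK ?num_real// lerXn2r ?nnegrE//.
  by rewrite addr_ge0//; exact: le_trans (Bh _ Fx).
apply: le_trans (_ : `|x - y| <= _).
  by rewrite [leRHS]mx_normrE; apply: le_trans (le_bigmax _ _ (ord0, k)) => //=.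
by rewrite (le_trans (ler_normB _ _))// lerD// Bh.
Qed.

Lemma facet_affine F (u : 'rV[R]_d) (a : R) t :
  dot u (facet_param F t) + a =
  dot (\row_i dot u (facet_edge F i)) t + (dot u (facet_vert F 0) + a).
Proof.
rewrite /facet_param dotDr dot_sumr addrAC addrC; congr (_ + _).
by apply: eq_bigr => i _; rewrite mxE dotZr mulrC.
Qed.

Lemma facet_vert_index F j : j \in F -> facet_vert F (index j (enum F)) = vert j.
Proof.
move=> jF; rewrite /facet_vert (nth_map j) ?index_mem ?mem_enum//.
by rewrite nth_index// mem_enum.
Qed.

Lemma facet_affine_eq0 F (u : 'rV[R]_d) (a : R) : #|F| = d ->
  \row_i dot u (facet_edge F i) = 0 -> dot u (facet_vert F 0) + a = 0 ->
  forall j, j \in F -> dot u (vert j) + a = 0.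
Proof.
move=> cF u0 ua j jF; rewrite -(facet_vert_index jF).
have : (index j (enum F) < d)%N by rewrite -[X in (_ < X)%N]cF cardE index_mem mem_enum.
case: (index j (enum F)) => [//|i id].
have id' : (i < d.-1)%N by rewrite -ltnS prednK// (leq_ltn_trans _ id).
move/rowP: u0 => /(_ (Ordinal id')); rewrite !mxE dotBr /= => /eqP.
by rewrite subr_eq0 => /eqP ->.
Qed.

Section in_simplex.
Variables (S F : {set 'I_(nvert T)}) (p : 'I_(nvert T) -> 'rV[R]_d) (q : 'I_(nvert T) -> R).
Hypotheses (pqS : barycentric S p q) (FS : F \subset S) (cF : #|F| = d).

(** The gradient of the barycentric coordinate of the vertex number [i0 + 1] of [F] takes the value
    1 on the edge [i0] and 0 on the other edges, so it extracts the coefficient [i0] of a vanishing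
    combination. *)
Lemma facet_edge_free : row_free (\matrix_i facet_edge F i).
Proof.
rewrite -kermx_eq0; apply/rowV0P => x /sub_kermxP; rewrite mulmx_sum_row.
under eq_bigr do rewrite rowK.
move=> x0; apply/rowP => i0; rewrite [RHS]mxE.
have id i : (i < d.-1)%N -> (i.+1 < size (enum F))%N.
  by rewrite -cardE cF; case: (d).
have [j0 _] : exists j, j \in F.
  by apply/set0Pn; rewrite -card_gt0 cF; case: (d) i0 => // -[].
pose j := nth j0 (enum F) i0.+1.
have fvE i : (i < size (enum F))%N -> dot (p j) (facet_vert F i) + q j = (i == i0.+1)%:R.
  move=> iF; rewrite /facet_vert (nth_map j0)//.
  have memS k : (k < size (enum F))%N -> nth j0 (enum F) k \in S.
    by move=> kF; apply: (fintype.subsetP FS); rewrite -mem_enum mem_nth.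
  case: pqS => _ _ ->; rewrite ?memS ?id//.
  by rewrite nth_uniq ?id// enum_uniq.
have := congr1 (dot (p j)) x0; rewrite dot0r dot_sumr (bigD1 i0)//= big1 => [|i ii0].
  rewrite addr0 dotZr dotBr.
  have := fvE _ (id _ (ltn_ord i0)).
  have := fvE 0%N (ltnW (id _ (leq_ltn_trans (leq0n _) (ltn_ord i0)))).
  by rewrite eqxx /= => e0 e1 /eqP; rewrite mulf_eq0 => /orP[/eqP//|/eqP]; lra.
rewrite dotZr dotBr.
have -> : dot (p j) (facet_vert F i.+1) = dot (p j) (facet_vert F 0).
  apply: (addIr (q j)); rewrite !fvE ?id//; last by rewrite (ltn_trans _ (id _ (ltn_ord i))).
  by rewrite eqSS (negPf (ii0 : i != i0 :> nat)).
by rewrite subrr mulr0.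
Qed.

Lemma facet_jacobian_gt0 : 0 < facet_jacobian F.
Proof.
rewrite sqrtr_gt0.
have -> : \matrix_(i, j) dot (facet_edge F i) (facet_edge F j) =
    (\matrix_i facet_edge F i) *m (\matrix_i facet_edge F i)^T.
  by apply/matrixP => i j; rewrite !mxE; apply: eq_bigr => k _; rewrite !mxE.
exact: gram_det_gt0 facet_edge_free.
Qed.

(** For [1 < d] a facet has two distinct vertices; on a line it would be a single point. *)
Lemma facet_diameter_gt0 : (1 < d)%N -> 0 < diameter F.
Proof.
rewrite -[X in (_ < X)%N]cF => /card_gt1P[i [j [iF jF ij]]].
apply: (diameter_gt0 iF jF); apply: contra_neq ij => ij.
by apply: (vert_inj_in pqS) => //; exact: (fintype.subsetP FS).
Qed.

(* With [k] the vertex opposite to [F] and [j0] in [F], skew-symmetry of [A] makes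
   the value at [k] orthogonal to [vert j - vert j0] for all the vertices [j]. *)
Lemma rigid_facet_eq0 (A : 'M[R]_d) (b : 'rV[R]_d) : (0 < d)%N -> #|S| = d.+1 ->
  A^T = - A -> (forall j, j \in F -> vert j *m A + b = 0) -> A = 0 /\ b = 0.
Proof.
move=> d0 cS skew Fb.
have [k kS kF] : exists2 k, k \in S & k \notin F.
  by apply/subsetPn; apply/negP => /subset_leq_card; rewrite cS cF ltnn.
have SE : S = k |: F.
  apply/esym/eqP; rewrite eqEcard cS cardsU1 kF cF add1n leqnn andbT.
  by rewrite finset.subUset finset.sub1set kS.
have [j0 j0F] : exists j, j \in F by apply/set0Pn; rewrite -card_gt0 cF.
have skewE x y : dot (x *m A) y = - dot (y *m A) x.
  rewrite !dotE -[in LHS](trmxK (x *m A *m y^T)) [LHS]mxE.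
  by rewrite trmx_mul trmxK trmx_mul skew mulNmx mulmxN mulmxA mxE.
pose u := vert k *m A + b.
have uE : u = (vert k - vert j0) *m A.
  by have /eqP := Fb _ j0F; rewrite addr_eq0 mulmxBl => /eqP ->; rewrite opprK.
have u0 : u = 0.
  have E x : dot u x - dot u (vert j0) = 0.
    rewrite (eq_affine_on_simplex pqS (v := 0) (b := 0)) ?dot0l ?addr0// => j.
    rewrite dot0l addr0 -dotBr uE SE !inE => /predU1P[->|jF].
      by have := skewE (vert k - vert j0) (vert k - vert j0); lra.
    have e i : i \in F -> vert i *m A = - b.
      by move=> iF; apply/eqP; rewrite -addr_eq0 Fb.
    by rewrite skewE mulmxBl !e// subrr dot0l oppr0.
  apply: dot_eq0P => x; have := E (vert j0 + x).
  by rewrite dotDr addrC addKr.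
(* The affine map now vanishes at all the vertices of [S], hence everywhere. *)
have f0 x : x *m A + b = 0.
  have [s1 sx _] := pqS.
  rewrite -[in LHS](sx x) mulmx_suml -[b]scale1r -(s1 x) scaler_suml -big_split/=.
  apply: big1 => j; rewrite SE !inE -scalemxAl -scalerDr => /predU1P[->|jF].
    by rewrite -/u u0 scaler0.
  by rewrite Fb// scaler0.
have b0 : b = 0 by rewrite -(f0 0) mul0mx add0r.
split=> //; apply/row_matrixP => i.
by rewrite rowE -[LHS]addr0 -b0 f0 row0.
Qed.

End in_simplex.

End facets.

(** * Integrals over facets and cells *)

Section ae_affine.
Context {R : realType} {n : nat}.

(** [A] is covered by a null set and the zero set of the function, which is also null unless [u] and
    [a] vanish. *)
Lemma ae_affine_eq0 (A : set 'rV[R]_n) (u : 'rV[R]_n) (a : R) :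
  measurable A -> (0 < lebesgue_rV R n A)%E ->
  {ae lebesgue_rV R n, forall t, A t -> dot u t + a = 0} -> u = 0 /\ a = 0.
Proof.
move=> mA A0 [N [mN N0 NA]]; apply: contrapT => ua.
pose Z := [set t : 'rV[R]_n | dot u t + a = 0].
have mZ : measurable Z by exact: measurable_affine_zeros.
have Z0 : lebesgue_rV R n Z = 0%E.
  apply: lebesgue_rV_affine_zeros; apply: contrapT => /not_orP[/negP + /negP].
  by rewrite !negbK => /eqP u0 /eqP a0; apply: ua.
suff /(negligibleP _ mA) A00 : (lebesgue_rV R n).-negligible A by rewrite A00 ltxx in A0.
apply: (@negligibleS _ _ _ _ (N `|` Z)).
  move=> t At; apply: contrapT => /not_orP[Nt Zt].
  by apply: Nt; apply: NA => /= /(_ At).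
by apply: negligibleU; apply/negligibleP.
Qed.

End ae_affine.

Section facet_integral_theory.
Context {R : realType} {d : nat} {T : mesh R d}.
Implicit Types (F : {set 'I_(nvert T)}) (g h : 'rV[R]_d -> R).
Local Notation simplex := (@unit_simplex R d).
Local Notation lam := (lebesgue_rV R d.-1).

Lemma measurable_unit_simplex : measurable simplex.
Proof.
have -> : simplex = rV_box (fun=> `[0, +oo[%classic) `&`
    [set t | dot (const_mx 1) t + 0 <= 1].
  rewrite /rV_box; apply/seteqP; split=> t /= [t0 t1]; split.
  - by move=> i; rewrite in_itv/= andbT.
  - by rewrite addr0 /dot; under eq_bigr do rewrite mxE mul1r.
  - by move=> i; have := t0 i; rewrite in_itv/= andbT.
  - by move: t1; rewrite addr0 /dot; under eq_bigr do rewrite mxE mul1r.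
apply: measurableI; first by apply: measurable_rV_box => i; exact: measurable_itv.
apply: closed_measurable_rV.
by apply: (closed_comp _ (@closed_le R 1)) => x _; exact: continuous_affine.
Qed.

Lemma bounded_unit_simplex : bounded_set simplex.
Proof.
exists 1; split; first exact: num_real.
move=> M M1 t [t0 t1]; rewrite /= [leLHS]mx_normrE; apply: bigmax_le => [|[i j] _ /=].
  exact: le_trans (ltW M1).
rewrite (ord1 i) ger0_norm//; apply: le_trans (ltW M1); apply: le_trans t1.
by rewrite (bigD1 j)//= lerDl sumr_ge0.
Qed.

Lemma unit_simplex_gt0 : (0 < lam simplex)%E.
Proof.
(* The sup-norm ball of radius [r] around [(r, ..., r)] has its [d - 1] coordinates between 0 and
   [2 r], so their sum stays at most 1; the successor keeps the denominator nonzero. *)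
pose r : R := (2 * d.-1.+1%:R)^-1.
have r0 : 0 < r by rewrite invr_gt0 mulr_gt0.
apply: lt_le_trans (lebesgue_rV_ball_gt0 (const_mx r) r0) _.
apply: le_measure; rewrite ?inE.
- by apply: open_measurable_rV; exact: ball_open.
- exact: measurable_unit_simplex.
move=> t [_ tr].
have ti i : 0 <= t ord0 i <= 2 * r.
  have := tr ord0 i; rewrite /ball/= mxE ltr_norml => /andP[h1 h2].
  by apply/andP; split; lra.
split=> [i|]; first by have /andP[] := ti i.
apply: (@le_trans _ _ (\sum_(i < d.-1) (2 * r))).
  by apply: ler_sum => i _; have /andP[] := ti i.
have -> : \sum_(i < d.-1) (2 * r) = d.-1%:R / d.-1.+1%:R.
  by rewrite sumr_const card_ord /r -[LHS]mulr_natl; field; rewrite nat1r pnatr_eq0.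
by rewrite ler_pdivrMr ?ltr0n// mul1r ler_nat.
Qed.

Lemma continuous_facet_param F : continuous (facet_param F).
Proof.
have -> : facet_param F = (fun t => t *m (\matrix_i facet_edge F i) + facet_vert F 0).
  apply/funext => t; rewrite mulmx_sum_row addrC; congr (_ + _).
  by apply: eq_bigr => i _; rewrite rowK.
exact: continuous_mulmxrD.
Qed.

Lemma facet_integrable F g : continuous g -> lam.-integrable simplex
  (EFin \o (fun t => g (facet_param F t))).
Proof.
move=> cg; apply: continuous_integrable_rV.
- exact: measurable_unit_simplex.
- exact: bounded_unit_simplex.
- by move=> t; apply: continuous_comp; [exact: continuous_facet_param|exact: cg].
Qed.

Lemma facet_intE F g : continuous g ->
  facet_int F g = facet_jacobian F * \int[lam]_(t in simplex) g (facet_param F t).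
Proof.
move=> cg; rewrite /facet_int /facet_integral fineM//.
apply: integrable_fin_num; first exact: measurable_unit_simplex.
exact: facet_integrable.
Qed.

Lemma facet_int_linear F k g h : continuous g -> continuous h ->
  facet_int F (fun x => k * g x + h x) = k * facet_int F g + facet_int F h.
Proof.
move=> cg ch; have ckg : continuous (fun x => k * g x).
  by move=> x; apply: (@continuousM _ _ (fun=> k) g x); [exact: cst_continuous|exact: cg].
rewrite !facet_intE// => [|x]; last first.
  by apply: (@cvgD _ R^o _ _ _ _ _ _ _ (ckg x)); exact: ch.
have mS := measurable_unit_simplex.
rewrite RintegralD ?RintegralZl//; [|exact: facet_integrable| |exact: facet_integrable].
- by rewrite mulrDr mulrCA.
- exact: (facet_integrable F ckg).
Qed.

Lemma facet_int_ge0 F g : continuous g -> (forall x, 0 <= g x) -> 0 <= facet_int F g.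
Proof.
move=> cg g0; rewrite facet_intE// mulr_ge0 ?sqrtr_ge0//.
by apply: Rintegral_ge0 => t _; exact: g0.
Qed.

Lemma facet_int_eq0 F g : continuous g -> (forall x, 0 <= g x) ->
  0 < facet_jacobian F -> facet_int F g = 0 ->
  {ae lam, forall t, simplex t -> g (facet_param F t) = 0}.
Proof.
move=> cg g0 J0; rewrite facet_intE// => /eqP; rewrite mulf_eq0 gt_eqF//= => /eqP g00.
have mS := measurable_unit_simplex; have ig := facet_integrable F cg.
have /ae_eq_integral_abs : (\int[lam]_(t in simplex) `|(g (facet_param F t))%:E| = 0)%E.
  under eq_integral do rewrite gee0_abs ?lee_fin//.
  by rewrite -[LHS]fineK ?[fine _]g00//; exact: integrable_fin_num.
move=> /(_ mS (measurable_int _ ig)).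
by apply: filterS => t /= h /h [].
Qed.

End facet_integral_theory.

(** * Cells: volume, projection onto constants, incidence with facets *)

Section cells.
Context {R : realType} {d : nat} {T : mesh R d}.
Implicit Types (S F : {set 'I_(nvert T)}) (c : 'I_(ncell T)).

Definition volume S : R := fine (lebesgue_rV R d (hull S)°).

Lemma measurable_interior (A : set 'rV[R]_d) : measurable A°.
Proof. by apply: open_measurable_rV; exact: open_interior. Qed.

Lemma bounded_hull_interior S : bounded_set (hull S)°.
Proof.
have [B hB] := hull_bounded S; exists B; split; first exact: num_real.
by move=> M BM x /interior_subset /hB /= xB; exact: le_trans xB (ltW BM).
Qed.

Lemma volume_gt0 S p q : S != finset.set0 -> barycentric S p q -> 0 < volume S.
Proof.
move=> /set0Pn[j jS] pq.
have [V [oV V0 _ VS]] := hull_open_near pq (vert_in_hull jS) (filterT : nbhs _ setT).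
rewrite fine_gt0//; apply/andP; split.
  apply: lebesgue_rV_open_gt0; first exact: open_interior.
  have [x Vx] := V0; exists x.
  by apply: filterS VS _; exact: open_nbhs_nbhs.
apply: lebesgue_rV_bounded; [exact: measurable_interior|exact: bounded_hull_interior].
Qed.

Lemma cell_int_cst c (k : R) : cell_int c (fun=> k) = k * volume (cell c).
Proof. by rewrite /cell_int Rintegral_cst//; exact: measurable_interior. Qed.

(** Testing with the indicator of the cell [c] shows that a projection has there the mean value of
    [q c]; the default value of [xget] is 0, nonnegative as well. *)
Lemma Pi_h_ge0 (q : field T R) c :
  (forall c, continuous (q c)) -> (forall c x, 0 <= q c x) ->
  0 < volume (cell c) -> 0 <= Pi_h q c.
Proof.
move=> cq q0 vc; rewrite /Pi_h; case: xgetP => [p _ pP|_]; last exact: lexx.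
have := pP (fun c' => (c' == c)%:R); rewrite (bigD1 c)//= big1 => [|c' c'c].
  rewrite addr0 eqxx /cell_int.
  under eq_Rintegral do rewrite mulr1.
  have mc := measurable_interior (hull (cell c)).
  have ic g : continuous g -> (lebesgue_rV R d).-integrable (hull (cell c))° (EFin \o g).
    by move=> cg; apply: continuous_integrable_rV => //; exact: bounded_hull_interior.
  rewrite RintegralB//; [|exact: ic|by apply: ic; exact: cst_continuous].
  rewrite -/(cell_int c (fun=> p c)) cell_int_cst => /eqP; rewrite subr_eq0 => /eqP pc.
  rewrite -(pmulr_lge0 _ vc) -pc; apply: Rintegral_ge0 => x _; exact: q0.
rewrite (negPf c'c) -[RHS](mul0r (volume (cell c'))) -cell_int_cst.
by apply: eq_Rintegral => x _; rewrite mulr0.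
Qed.

Lemma dirichlet_facet (gammaD : set 'rV[R]_d) : closed gammaD ->
  (0 < boundary_measure T gammaD)%E -> exists2 F, F \in boundary_facets T &
  (0 < lebesgue_rV R d.-1 (facet_param F @^-1` gammaD `&` @unit_simplex R d))%E.
Proof.
move=> cD; apply: contraPP => nF; apply/negP; rewrite -leNgt.
rewrite /boundary_measure big1// => F FB.
have mD : measurable (facet_param F @^-1` gammaD).
  apply: closed_measurable_rV; apply: closed_comp => // t _.
  exact: continuous_facet_param.
rewrite /facet_integral.
rewrite (eq_integral (fun t => (\1_(facet_param F @^-1` gammaD) t)%:E)) => [|t _].
  rewrite integral_indic//; last exact: measurable_unit_simplex.
  rewrite -[RHS](mule0 (facet_jacobian F)%:E); congr (_ * _)%E.
  apply/eqP; apply: contrapT => /negP D0; apply: nF; exists F => //.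
  by rewrite lt0e D0/=.
by rewrite !indicE.
Qed.

Lemma cells_inter F c c' : injective (@cell R d T) -> c != c' ->
  #|cell c| = d.+1 -> #|cell c'| = d.+1 -> #|F| = d ->
  F \subset cell c -> F \subset cell c' -> cell c :&: cell c' = F.
Proof.
move=> injc cc' cc cc1 cF Fc Fc'; apply/esym/eqP.
rewrite eqEcard finset.subsetI Fc Fc' cF /= -ltnS -cc.
rewrite ltn_neqAle subset_leq_card ?finset.subsetIl// andbT.
apply: contra_neq cc' => ccE; apply: injc.
have /eqP E1 : cell c :&: cell c' == cell c by rewrite eqEcard finset.subsetIl ccE /=.
have /eqP E2 : cell c :&: cell c' == cell c'.
  by rewrite eqEcard finset.subsetIr ccE cc cc1 /=.
by rewrite -[LHS]E1.
Qed.

(** A third cell would lie on the same side of the facet as one of the two cells named by the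
    orientation. *)
Lemma internal_facet_cells (Omega : set 'rV[R]_d) (o : orientation T) F c :
  (0 < d)%N -> matching_mesh_of T Omega -> well_oriented o ->
  F \in internal_facets T -> F \subset cell c -> c = cplus o F \/ c = cminus o F.
Proof.
move=> d0 [injc cells matching _] ho FI Fc; apply: contrapT => /not_orP[/eqP cp /eqP cm].
have [[Fp Fm _] n1 nF np nm] := ho _ FI.
have cF : #|F| = d by move: FI; rewrite inE => /andP[/eqP].
have [j0 j0F] : exists j, j \in F by apply/set0Pn; rewrite -card_gt0 cF.
have bary (c' : 'I_(ncell T)) : exists p q, barycentric (cell c') p q.
  by apply: barycentric_exists; have [] := cells c'.
set n := normal o F in n1 nF np nm.
have n0 : n != 0.
  apply: contra_eq_neq n1 => ->.
  by rewrite /enorm dot0r sqrtr0 eq_sym oner_eq0.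
pose a := - dot n (vert j0).
have aE x : dot n x + a = dot n (x - vert j0) by rewrite dotBr.
have h0 := vert_in_hull j0F.
have [k kc kF] : exists2 k, k \in cell c & k \notin F.
  by apply/subsetPn; apply/negP => /subset_leq_card; rewrite (cells c).1 cF ltnn.
have cE : cell c = k |: F.
  apply/esym/eqP; rewrite eqEcard (cells c).1 cardsU1 kF cF add1n leqnn andbT.
  by rewrite finset.subUset finset.sub1set kc.
have nF0 j : j \in F -> dot n (vert j) + a = 0.
  by move=> jF; rewrite aE nF//; exact: vert_in_hull.
have [p [q pq]] := bary c.
(* The side of the vertex [k] opposite to the facet decides which of the two cells is the
   competitor; for [cminus] the normal is reversed. *)
have [kle|kge] := leP (dot n (vert k) + a) 0.
  have [p' [q' pq']] := bary (cplus o F).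
  have E : cell c :&: cell (cplus o F) = F.
    by apply: cells_inter => //; [exact: (cells _).1|exact: (cells _).1].
  apply: (simplices_not_same_side pq pq' (n := n) (a := a)); rewrite ?E//.
  - exact: (cells _).1.
  - exact: (cells _).1.
  - by rewrite matching E.
  - by move=> j; rewrite cE finset.inE finset.in_set1 => /predU1P[->//|/nF0 ->].
  - by move=> j jc; rewrite aE; apply: np => //; exact: vert_in_hull.
have [p' [q' pq']] := bary (cminus o F).
have E : cell c :&: cell (cminus o F) = F.
  by apply: cells_inter => //; [exact: (cells _).1|exact: (cells _).1].
have NE x : dot (- n) x - a = - (dot n x + a) by rewrite dotNl opprD.
apply: (simplices_not_same_side pq pq' (n := - n) (a := - a)); rewrite ?E ?oppr_eq0//.
- exact: (cells _).1.
- exact: (cells _).1.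
- by rewrite matching E.
- by move=> j jF; rewrite NE nF0// oppr0.
- move=> j; rewrite cE finset.inE finset.in_set1 NE oppr_le0 => /predU1P[->|/nF0 ->//].
  exact: ltW.
- by move=> j jc; rewrite NE oppr_le0 aE; apply: nm => //; exact: vert_in_hull.
Qed.

End cells.

(** * Bilinear forms on subspaces and affine fields *)

Section finite_dimensional.
Context {R : fieldType} {V : vectType R}.

(** Among the subspaces included in [P], one of maximal dimension cannot be enlarged by a vector of
    [P], so it contains them all. This provides a basis for a subspace given as a predicate. *)
Lemma subspace_vspace (P : V -> Prop) : P 0 ->
  (forall k x y, P x -> P y -> P (k *: x + y)) ->
  exists W : {vspace V}, forall x, x \in W <-> P x.
Proof.
move=> P0 PD.
pose sub (W : {vspace V}) := forall x, x \in W -> P x.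
have exW : exists k, `[< exists2 W, sub W & \dim W = k >].
  exists 0%N; apply/asboolP; exists 0%VS; last by rewrite dimv0.
  by move=> x; rewrite memv0 => /eqP ->.
have ubW k : `[< exists2 W, sub W & \dim W = k >] -> (k <= \dim {:V})%N.
  by move=> /asboolP[W _ <-]; exact/dimvS/subvf.
have [k /asboolP[W subW dimW] maxW] := ex_maxnP exW ubW.
exists W => x; split=> [|Px]; first exact: subW.
have WW' : (W <= W + <[x]>)%VS by exact: addvSl.
have : (W == W + <[x]>)%VS.
  rewrite eqEdim WW' dimW /=; apply: maxW; apply/asboolP.
  exists (W + <[x]>)%VS => // y /memv_addP[w /subW Pw [z /vlineP[l ->] ->]].
  by rewrite addrC; exact: PD.
by move/eqP ->; rewrite (subvP (addvSr _ _))// memv_line.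
Qed.

(** The matrix of [b] in a basis of the subspace is invertible, since a vector [x] in its left
    kernel satisfies [b x x = 0]. *)
Lemma definite_form_solvable (P : V -> Prop) (b : V -> V -> R) (l : V -> R) :
  P 0 -> (forall k x y, P x -> P y -> P (k *: x + y)) ->
  (forall y, scalar (b^~ y)) -> (forall x, scalar (b x)) -> scalar l ->
  (forall x, P x -> b x x = 0 -> x = 0) ->
  exists2 w, P w & forall y, P y -> b w y = l y.
Proof.
move=> P0 PD bl br ll bdef; have [W WP] := subspace_vspace P0 PD.
have comb (f : V -> R) (fl : scalar f) n (x : 'I_n -> R) (e : 'I_n -> V) :
    f (\sum_i x i *: e i) = \sum_i x i * f (e i).
  have f0 : f 0 = 0 by have := fl (-1) 0 0; rewrite scaler0 addr0 mulN1r addNr.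
  by elim/big_rec2 : _ => [//|i u v _ <-]; rewrite fl.
pose e (i : 'I_(\dim W)) : V := (vbasis W)`_i.
pose M : 'M[R]_(\dim W) := \matrix_(i, j) b (e i) (e j).
have We (x : 'rV[R]_(\dim W)) : P (\sum_i x ord0 i *: e i).
  by apply/WP/memv_suml => i _; rewrite memvZ// vbasis_mem// mem_nth ?size_tuple.
have expand y : P y -> exists x : 'rV_(\dim W), y = \sum_i x ord0 i *: e i.
  move=> /WP Wy; exists (\row_i coord (vbasis W) i y).
  by rewrite [LHS](coord_vbasis Wy); apply: eq_bigr => i _; rewrite mxE.
have bM (x : 'rV[R]_(\dim W)) j : b (\sum_i x ord0 i *: e i) (e j) = (x *m M) ord0 j.
  by rewrite (comb _ (bl _)) mxE; apply: eq_bigr => i _; rewrite mxE.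
have Mu : M \in unitmx.
  rewrite -row_free_unit -kermx_eq0; apply/rowV0P => x /sub_kermxP xM.
  have /(bdef _ (We x)) : b (\sum_i x ord0 i *: e i) (\sum_i x ord0 i *: e i) = 0.
    by rewrite (comb _ (br _)) big1// => i _; rewrite bM xM mxE mulr0.
  have /freeP fr := basis_free (vbasisP W).
  by move=> /fr x0; apply/rowP => i; rewrite x0 mxE.
pose x := (\row_j l (e j)) *m invmx M.
exists (\sum_i x ord0 i *: e i) => // y /expand[z ->].
rewrite (comb _ (br _)) (comb _ ll); apply: eq_bigr => j _.
by rewrite bM /x mulmxKV// mxE.
Qed.

End finite_dimensional.

Section affine_fields.
Context {R : realType} {d : nat} {T : mesh R d}.

(** A finite-dimensional model of [P1v]: on each cell, the pair [(A, b)] stands for the affine map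
    sending [x] to [x *m A + b]. *)
Definition coefs := {ffun 'I_(ncell T) -> 'M[R]_d * 'rV[R]_d}.
HB.instance Definition _ := Vector.on coefs.

Definition affine_field (M : coefs) : field T 'rV[R]_d :=
  fun c x => x *m (M c).1 + (M c).2.

Lemma P1v_affine_field (u : field T 'rV[R]_d) : P1v u <-> exists M, u = affine_field M.
Proof.
split=> [u1|[M ->] c].
  have /choice[M uM] c : exists M : 'M[R]_d * 'rV[R]_d, forall x, u c x = x *m M.1 + M.2.
    have [L [b ub]] := u1 c; exists (lin1_mx L, b) => x.
    by rewrite /= mul_rV_lin1 ub.
  exists [ffun c => M c]; apply/funext => c; apply/funext => x.
  by rewrite /affine_field ffunE uM.
by exists (mulmxr (M c).1), (M c).2.
Qed.

Lemma affine_field_linear k M N c x :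
  affine_field (k *: M + N) c x = k *: affine_field M c x + affine_field N c x.
Proof.
rewrite /affine_field !ffunE /= mulmxDr -scalemxAr scalerDr.
by rewrite !addrA; congr (_ + _); rewrite addrAC.
Qed.

Lemma diff_linearD (V W : normedModType R) (f : {linear V -> W}) (b : W) x :
  continuous f -> 'd (fun y => f y + b) x = f :> (V -> W).
Proof.
move=> cf.
have df := linear_differentiable x cf.
have db : differentiable (cst b : V -> W) x by exact: differentiable_cst.
apply/funext => y; apply: (etrans (congr1 (@^~ y) (diffD df db))).
have ef : 'd f x y = f y := congr1 (@^~ y) (diff_lin x cf).
have eb : 'd (cst b : V -> W) x y = 0 := congr1 (@^~ y) (diff_cst b x).
exact: etrans (congr2 +%R ef eb) (addr0 _).
Qed.

Lemma jacobian_affine (A : 'M[R]_d) (b : 'rV[R]_d) (x : 'rV[R]_d) :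
  'J (fun y : 'rV[R]_d => y *m A + b) x = A.
Proof.
have cA : continuous (mulmxr A : 'rV[R]_d -> 'rV[R]_d) by exact: continuous_mulmxr.
have dA := @diff_linearD 'rV[R]_d 'rV[R]_d (mulmxr A) b x cA.
by apply/row_matrixP => i; rewrite !rowE /jacobian mul_rV_lin1 dA.
Qed.

End affine_fields.

(** * The discrete form *)

Section scalar_theory.
Context {R : realType} {V : lmodType R}.

Lemma scalarD (f g : V -> R) : scalar f -> scalar g -> scalar (fun x => f x + g x).
Proof. by move=> sf sg k x y; rewrite sf sg mulrDr addrACA. Qed.

Lemma scalarN (f : V -> R) : scalar f -> scalar (fun x => - f x).
Proof. by move=> sf k x y; rewrite sf opprD mulrN. Qed.

Lemma scalarB (f g : V -> R) : scalar f -> scalar g -> scalar (fun x => f x - g x).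
Proof. by move=> sf sg; apply: scalarD => //; exact: scalarN. Qed.

Lemma scalarMl (a : R) (f : V -> R) : scalar f -> scalar (fun x => a * f x).
Proof. by move=> sf k x y; rewrite sf mulrDr mulrCA. Qed.

Lemma scalarMr (a : R) (f : V -> R) : scalar f -> scalar (fun x => f x * a).
Proof. by move=> sf k x y; rewrite sf mulrDl mulrA. Qed.

Lemma scalar_sum I (r : seq I) (P : pred I) (f : I -> V -> R) :
  (forall i, P i -> scalar (f i)) -> scalar (fun x => \sum_(i <- r | P i) f i x).
Proof.
move=> sf k x y; rewrite mulr_sumr -big_split/=.
by apply: eq_bigr => i Pi; rewrite sf.
Qed.

Lemma scalar_facet_int d (T : mesh R d) (F : {set 'I_(nvert T)})
    (g : V -> 'rV[R]_d -> R) : (forall x, scalar (g^~ x)) ->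
  (forall v, continuous (g v)) -> scalar (fun v => facet_int F (g v)).
Proof.
move=> sg cg k v w; rewrite -facet_int_linear//.
by congr facet_int; apply/funext => x; exact: sg.
Qed.

End scalar_theory.

(** * Linearity of strain, stress and contractions *)

Section tensors.
Context {R : realType} {d : nat}.
Implicit Types (A B C : 'M[R]_d) (x y z : 'rV[R]_d).

(** The strain of [x *m A + b]: its Jacobian on row vectors is [A], so its gradient is [A^T], and
    the summands come in the order of [e_h]. *)
Definition sym A : 'M[R]_d := 2^-1 *: (A^T + A).

Lemma sym_linear k A B : sym (k *: A + B) = k *: sym A + sym B.
Proof. by apply/matrixP => i j; rewrite !mxE; ring. Qed.

Lemma hooke_linear lambda mu k A B :
  hooke lambda mu (k *: A + B) = k *: hooke lambda mu A + hooke lambda mu B.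
Proof.
rewrite /hooke mxtraceD mxtraceZ; apply/matrixP => i j; rewrite !mxE.
by case: (i == j); rewrite ?mulr1n ?mulr0n; ring.
Qed.

Lemma tensor_vec_linear k A B x :
  tensor_vec (k *: A + B) x = k *: tensor_vec A x + tensor_vec B x.
Proof. by rewrite /tensor_vec linearP /= mulmxDr -scalemxAr. Qed.

Lemma ddot_linearl k A B C : ddot (k *: A + B) C = k * ddot A C + ddot B C.
Proof.
rewrite /ddot mulr_sumr -big_split; apply: eq_bigr => i _ /=.
rewrite mulr_sumr -big_split; apply: eq_bigr => j _ /=.
by rewrite !mxE; ring.
Qed.

Lemma ddot_linearr k A B C : ddot A (k *: B + C) = k * ddot A B + ddot A C.
Proof.
rewrite /ddot mulr_sumr -big_split; apply: eq_bigr => i _ /=.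
rewrite mulr_sumr -big_split; apply: eq_bigr => j _ /=.
by rewrite !mxE; ring.
Qed.

Lemma dot_linearl k x y z : dot (k *: x + y) z = k * dot x z + dot y z.
Proof. by rewrite dotDl dotZl. Qed.

Lemma dot_linearr k x y z : dot x (k *: y + z) = k * dot x y + dot x z.
Proof. by rewrite dotDr dotZr. Qed.

Lemma continuous_dot_comp n (f g : 'rV[R]_n -> 'rV[R]_d) : continuous f -> continuous g ->
  continuous (fun t => dot (f t) (g t)).
Proof.
move=> cf cg t; have ft := nbhs_filter t.
apply: (@cvg_big _ _ _ _ _ (@add_continuous R) _ _ _
  (fun i (s : 'rV[R]_n) => f s ord0 i * g s ord0 i)
  (fun i => f t ord0 i * g t ord0 i) ft) => i _.
have cc (h : 'rV[R]_n -> 'rV[R]_d) : continuous h -> h s ord0 i @[s --> t] --> h t ord0 i.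
  by move=> ch; exact: (@continuous_comp _ _ _ h (fun v : 'rV[R]_d => v ord0 i) t (ch t)
    (@coord_continuous R 1 d ord0 i (h t))).
by apply: cvgM; exact: cc.
Qed.

End tensors.

Section bilinear_form.
Context {R : realType} {d : nat} {T : mesh R d}.
Variables (o : orientation T) (lambda mu eta zeta : R) (a : R -> R) (alpha : field T R).
Implicit Types (M N : @coefs R d T) (F : {set 'I_(nvert T)}).

Let wt c := a_h a alpha c + eta.

Let form M N := form_h o lambda mu eta zeta a alpha (affine_field M) (affine_field N).

(** The stress of an affine field is constant on each cell, so neither [stress] nor the weighted
    average [flux] below depends on the point. *)
Let stress M c : 'M[R]_d := hooke lambda mu (sym (M c).1).

Let flux F M : 'rV[R]_d := (avg_weight o eta a alpha F)^-1 *: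
  avg o F (fun c => wt c *: tensor_vec (wt c *: stress M c) (normal o F)).

Let J F M x := jump o F (affine_field M) x.

Lemma e_h_affine M c x : e_h (affine_field M) c x = sym (M c).1.
Proof. by rewrite /e_h /grad_h jacobian_affine trmxK. Qed.

Let stress_linear k M N c : stress (k *: M + N) c = k *: stress M c + stress N c.
Proof. by rewrite /stress !ffunE /= sym_linear hooke_linear. Qed.

Let flux_linear F k M N : flux F (k *: M + N) = k *: flux F M + flux F N.
Proof.
rewrite /flux /avg !stress_linear.
have E c : tensor_vec (wt c *: (k *: stress M c + stress N c)) (normal o F) =
    k *: tensor_vec (wt c *: stress M c) (normal o F) +
    tensor_vec (wt c *: stress N c) (normal o F).
  by rewrite -tensor_vec_linear scalerDr !scalerA mulrC.
rewrite !E; set u := _^-1.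
move: (tensor_vec _ _) (tensor_vec _ _) (tensor_vec _ _) (tensor_vec _ _) => x y z w.
move: (wt _) (wt _) u 2^-1 => p q r s.
by apply/rowP => i; rewrite !mxE; ring.
Qed.

Let J_linear F k M N x : J F (k *: M + N) x = k *: J F M x + J F N x.
Proof.
rewrite /J /jump !affine_field_linear scalerBr opprD addrACA.
by rewrite -!addrA; congr (_ + _); rewrite addrCA.
Qed.

Let continuous_J F M : continuous (J F M).
Proof.
have -> : J F M = fun x => x *m ((M (cplus o F)).1 - (M (cminus o F)).1) +
    ((M (cplus o F)).2 - (M (cminus o F)).2).
  by apply/funext => x; rewrite /J /jump /affine_field mulmxBr opprD addrACA.
exact: continuous_mulmxrD.
Qed.

(** Cell integrals become constants times volumes, which leaves only facet integrals of continuous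
    functions. *)
Let form_affineE M N : form M N =
  \sum_c wt c * ddot (stress M c) (sym (N c).1) * volume (cell c)
  - \sum_(F in internal_facets T) facet_int F (fun x =>
      dot (flux F M) (J F N x) - dot (flux F N) (J F M x))
  + \sum_(F in internal_facets T) zeta / diameter F * gamma_h o eta a alpha F *
      facet_int F (fun x => dot (J F M x) (J F N x)).
Proof.
have wavgE F K x : wavg o eta a alpha F (fun c y => (a_h a alpha c + eta) *:
    sigma_h lambda mu (affine_field K) c y) x = flux F K.
  by rewrite /wavg /sigma_h /avg !e_h_affine.
apply: (congr2 +%R); first apply: (congr2 (fun x y => x - y)).
- apply: eq_bigr => c _; rewrite -cell_int_cst.
  by congr cell_int; apply/funext => x; rewrite !e_h_affine.
- apply: eq_bigr => F _; apply: (congr1 (facet_int F)); apply/funext => x.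
  exact: (congr2 (fun u v => dot u (J F N x) - dot v (J F M x)) (wavgE F M x) (wavgE F N x)).
- by [].
Qed.

Let continuous_flux_jump F M N :
  continuous (fun x => dot (flux F M) (J F N x) - dot (flux F N) (J F M x)).
Proof.
have c K L : continuous (fun x => dot (flux F K) (J F L x)).
  by apply: continuous_dot_comp; [exact: cst_continuous|exact: continuous_J].
by move=> x; apply: (@cvgB _ R^o _ _ _ _ _ _ _ (c M N x)); exact: c.
Qed.

Let continuous_jumps F M N : continuous (fun x => dot (J F M x) (J F N x)).
Proof. by apply: continuous_dot_comp; exact: continuous_J. Qed.

Lemma form_h_linearl N : scalar (fun M => form_h o lambda mu eta zeta a alpha
  (affine_field M) (affine_field N)).
Proof.
under eq_fun do rewrite -/(form _ _) form_affineE.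
apply: scalarD; first apply: scalarB.
- apply: scalar_sum => c _; apply: scalarMr; apply: scalarMl => k M M'.
  by rewrite stress_linear ddot_linearl.
- apply: scalar_sum => F _; apply: scalar_facet_int => [x|M].
    apply: scalarB => k M M'; first by rewrite flux_linear dot_linearl.
    by rewrite J_linear dot_linearr.
  exact: continuous_flux_jump.
- apply: scalar_sum => F _; apply/scalarMl/scalar_facet_int => [x|M].
    by move=> k M M'; rewrite J_linear dot_linearl.
  exact: continuous_jumps.
Qed.

Lemma form_h_linearr M : scalar (fun N => form_h o lambda mu eta zeta a alpha
  (affine_field M) (affine_field N)).
Proof.
under eq_fun do rewrite -/(form _ _) form_affineE.
apply: scalarD; first apply: scalarB.
- apply: scalar_sum => c _; apply: scalarMr; apply: scalarMl => k N N'.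
  by rewrite !ffunE sym_linear ddot_linearr.
- apply: scalar_sum => F _; apply: scalar_facet_int => [x|N].
    apply: scalarB => k N N'; first by rewrite J_linear dot_linearr.
    by rewrite flux_linear dot_linearl.
  exact: continuous_flux_jump.
- apply: scalar_sum => F _; apply/scalarMl/scalar_facet_int => [x|N].
    by move=> k N N'; rewrite J_linear dot_linearr.
  exact: continuous_jumps.
Qed.

Lemma form_h_diag M :
  form_h o lambda mu eta zeta a alpha (affine_field M) (affine_field M) =
  \sum_c (a_h a alpha c + eta) *
    ddot (hooke lambda mu (sym (M c).1)) (sym (M c).1) * volume (cell c)
  + \sum_(F in internal_facets T) zeta / diameter F * gamma_h o eta a alpha F *
      facet_int F (fun x =>
        dot (jump o F (affine_field M) x) (jump o F (affine_field M) x)).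
Proof.
rewrite -/(form _ _) form_affineE [X in _ - X]big1 ?subr0// => F _.
under [X in facet_int F X]eq_fun do rewrite subrr.
(* The integral of the zero function vanishes by linearity, zero being written as [-1 * 0 + 0]. *)
rewrite -[RHS](addNr (facet_int F (fun=> 0))) -mulN1r -facet_int_linear.
- by congr facet_int; apply/funext => x; rewrite mulr0 addr0.
- exact: cst_continuous.
- exact: cst_continuous.
Qed.

Lemma continuous_jump_sq M F : continuous (fun x =>
  dot (jump o F (affine_field M) x) (jump o F (affine_field M) x)).
Proof. exact: continuous_jumps. Qed.

Hypotheses (hC : hooke_posdef d lambda mu) (heta : 0 < eta) (hzeta : 0 < zeta).
Hypothesis a_h_ge0 : forall c, 0 <= a_h a alpha c.
Hypothesis vol_gt0 : forall c, 0 < volume (cell c : {set 'I_(nvert T)}).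
Hypothesis diam_gt0 : forall F, F \in internal_facets T -> 0 < diameter F.

Lemma form_h_diag_eq0 M :
  form_h o lambda mu eta zeta a alpha (affine_field M) (affine_field M) = 0 ->
  (forall c, sym (M c).1 = 0) /\
  (forall F, F \in internal_facets T -> facet_int F (fun x =>
     dot (jump o F (affine_field M) x) (jump o F (affine_field M) x)) = 0).
Proof.
(* The projected [a] may vanish on a cell, where the material is fully damaged; [eta] then keeps the
   weight positive. *)
have w0 c : 0 < a_h a alpha c + eta by exact: ltr_wpDl.
have g0 F : 0 < gamma_h o eta a alpha F.
  by rewrite /gamma_h divr_gt0 ?mulr_gt0// addr_gt0.
have symT (A : 'M[R]_d) : (sym A)^T = sym A.
  by apply/matrixP => i j; rewrite !mxE addrC.
have hooke_ge0 (A : 'M[R]_d) : 0 <= ddot (hooke lambda mu (sym A)) (sym A).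
  have [->|A0] := eqVneq (sym A) 0; last by rewrite ltW// hC.
  by rewrite /ddot big1// => i _; rewrite big1// => j _; rewrite [X in _ * X]mxE mulr0.
have cell0 c : 0 <= (a_h a alpha c + eta) *
    ddot (hooke lambda mu (sym (M c).1)) (sym (M c).1) * volume (cell c).
  by rewrite mulr_ge0 ?mulr_ge0// ltW.
have facet_ge0 F : 0 <= facet_int F (fun x =>
     dot (jump o F (affine_field M) x) (jump o F (affine_field M) x)).
  by apply: facet_int_ge0 => [|x]; [exact: continuous_jump_sq|exact: dot_ge0].
have k0 F : F \in internal_facets T -> 0 < zeta / diameter F * gamma_h o eta a alpha F.
  by move=> FI; rewrite mulr_gt0// divr_gt0// diam_gt0.
rewrite form_h_diag => /eqP; rewrite paddr_eq0; last 2 first.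
- by apply: sumr_ge0 => c _.
- by apply: sumr_ge0 => F FI; rewrite mulr_ge0// ltW// k0.
move=> /andP[/eqP cells0 /eqP facets0]; split=> [c|F FI].
  apply/eqP; apply: contraT => A0; exfalso.
  have : (a_h a alpha c + eta) *
      ddot (hooke lambda mu (sym (M c).1)) (sym (M c).1) * volume (cell c) = 0.
    by apply: (psumr_eq0P _ cells0) => // i _; exact: cell0.
  by move/eqP; rewrite !mulf_eq0 (gt_eqF (w0 _)) (gt_eqF (vol_gt0 _)) gt_eqF// hC.
have : zeta / diameter F * gamma_h o eta a alpha F * facet_int F (fun x =>
     dot (jump o F (affine_field M) x) (jump o F (affine_field M) x)) = 0.
  by apply: (psumr_eq0P _ facets0) => // E EI; rewrite mulr_ge0// ltW// k0.
by move/eqP; rewrite mulf_eq0 (gt_eqF (k0 _ FI)) => /eqP.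
Qed.

End bilinear_form.

(** * Definiteness of the discrete form and well-posedness *)

Section definiteness.
Context {R : realType} {d : nat} {T : mesh R d}.

(** Each component, pulled back by [facet_param], is an affine function vanishing almost everywhere
    on [D], so its coefficients are zero. Below, [D] is the whole unit simplex for the jumps and the
    part of it mapped into [gammaD] for the Dirichlet condition. *)
Lemma facet_vanishing (F : {set 'I_(nvert T)}) (D : set 'rV[R]_d.-1)
    (A : 'M[R]_d) (b : 'rV[R]_d) : #|F| = d ->
  measurable D -> (0 < lebesgue_rV R d.-1 D)%E ->
  {ae lebesgue_rV R d.-1, forall t, D t -> facet_param F t *m A + b = 0} ->
  forall j, j \in F -> vert j *m A + b = 0.
Proof.
move=> cF mD D0 aeD j jF; apply/rowP => i; rewrite [RHS]mxE.
have E (x : 'rV[R]_d) : (x *m A + b) ord0 i = dot (col i A)^T x + b ord0 i.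
  by rewrite !mxE; congr (_ + _); apply: eq_bigr => k _; rewrite !mxE mulrC.
have [|u0 a0] := @ae_affine_eq0 R d.-1 D (\row_k dot (col i A)^T (facet_edge F k))
    (dot (col i A)^T (facet_vert F 0) + b ord0 i) mD D0.
  apply: filterS aeD => t /= tD Dt.
  by rewrite -facet_affine -E tD// mxE.
by rewrite E (facet_affine_eq0 cF u0 a0).
Qed.

Variables (Omega gammaD : set 'rV[R]_d) (o : orientation T).
Hypotheses (d1 : (1 < d)%N) (oOmega : open Omega) (cOmega : connected Omega).
Hypotheses (hT : matching_mesh_of T Omega) (ho : well_oriented o).
Hypotheses (hD : closed gammaD) (hDpos : (0 < boundary_measure T gammaD)%E).
Variables (lambda mu eta zeta : R) (a : R -> R) (alpha : field T R).
Hypotheses (hC : hooke_posdef d lambda mu) (heta : 0 < eta) (hzeta : 0 < zeta).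
Hypotheses (ca : continuous a) (a_ge0 : forall x, 0 <= a x) (halpha : P1s alpha).

Let bary (c : 'I_(ncell T)) : exists p q, barycentric (cell c) p q.
Proof.
have [_ cells _ _] := hT.
by apply: barycentric_exists; have [] := cells c.
Qed.

Let card_cell (c : 'I_(ncell T)) : #|cell c| = d.+1.
Proof. by have [_ cells _ _] := hT; have [] := cells c. Qed.

Let volume_cell_gt0 (c : 'I_(ncell T)) : 0 < volume (cell c).
Proof.
have [p [q pq]] := bary c.
by apply: volume_gt0 pq; rewrite -card_gt0 card_cell.
Qed.

Lemma a_h_ge0 (c : 'I_(ncell T)) : 0 <= a_h a alpha c.
Proof.
apply: Pi_h_ge0 => // c' x; have [L [b Lb]] := halpha c'.
apply: (@continuous_comp _ _ _ (alpha c') a); last exact: ca.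
have -> : alpha c' = (fun y => dot (\row_i L (delta_mx ord0 i)) y + b).
  apply/funext => y; rewrite Lb {1}(row_sum_delta y) linear_sum; congr (_ + _).
  by apply: eq_bigr => i _; rewrite linearZ mxE mulrC.
exact: continuous_affine.
Qed.

Lemma form_h_definite (M : @coefs R d T) :
  eq_on gammaD (affine_field M) (fun _ _ => 0) ->
  form_h o lambda mu eta zeta a alpha (affine_field M) (affine_field M) = 0 -> M = 0.
Proof.
move=> MD M0; have d0 : (0 < d)%N by exact: ltnW.
have [injc cells matching cover] := hT.
have simplexS := @measurable_unit_simplex R d.
have [] := form_h_diag_eq0 hC heta hzeta a_h_ge0 volume_cell_gt0 _ M0.
  move=> F FI; have [[Fp _ _] _ _ _ _] := ho FI.
  have [p [q pq]] := bary (cplus o F).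
  apply: facet_diameter_gt0 pq Fp _ d1.
  by move: FI; rewrite inE => /andP[/eqP].
move=> symM jumpM.
have skew c : ((M c).1)^T = - (M c).1.
  have /eqP := symM c; rewrite scaler_eq0 invr_eq0 pnatr_eq0 /= addr_eq0.
  by move/eqP.
(* The difference of two rigid motions is again one, so it is zero if it vanishes at the vertices of
   a facet. *)
have rigid c c' (F : {set 'I_(nvert T)}) : F \subset cell c -> #|F| = d ->
    (forall j, j \in F -> vert j *m ((M c).1 - (M c').1) + ((M c).2 - (M c').2) = 0) ->
    M c = M c'.
  move=> Fc cF FM; have [p [q pq]] := bary c.
  have [|A0 b0] := rigid_facet_eq0 pq Fc cF d0 (card_cell c) _ FM.
    by rewrite linearB /= !skew opprB addrC opprK.
  by apply/eqP; rewrite -pair_eqE /= -subr_eq0 A0 eqxx -subr_eq0 b0 eqxx.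
have adj (F : {set 'I_(nvert T)}) : F \in internal_facets T -> M (cplus o F) = M (cminus o F).
  move=> FI; have [[Fp Fm _] _ _ _ _] := ho FI.
  have cF : #|F| = d by move: FI; rewrite inE => /andP[/eqP].
  have [p [q pq]] := bary (cplus o F).
  apply: (rigid _ _ F Fp cF).
  apply: (facet_vanishing cF simplexS unit_simplex_gt0).
  have := facet_int_eq0 (@continuous_jump_sq R d T o M F) (fun x => dot_ge0 _)
    (facet_jacobian_gt0 pq Fp cF) (jumpM _ FI).
  apply: filterS => t /= h /h /eqP; rewrite dot_eq0 => /eqP <-.
  by rewrite /jump /affine_field mulmxBr opprD addrACA.
have [F FB FD] := dirichlet_facet hD hDpos.
have [cF [c0 c0F]] : #|F| = d /\ exists c, F \subset cell c.
  move: FB; rewrite inE => /andP[/eqP cF /eqP c1]; split=> //.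
  have /set0Pn[c] : cells_of F != finset.set0 by rewrite -card_gt0 c1.
  by rewrite inE => Fc; exists c.
have Mc0 : M c0 = 0.
  have [p [q pq]] := bary c0.
  have mD : measurable (facet_param F @^-1` gammaD `&` @unit_simplex R d).
    apply: measurableI => //; apply: closed_measurable_rV.
    by apply: closed_comp => // t _; exact: continuous_facet_param.
  have aeD : {ae lebesgue_rV R d.-1, forall t,
      (facet_param F @^-1` gammaD `&` @unit_simplex R d) t ->
      facet_param F t *m (M c0).1 + (M c0).2 = 0}.
    have MDF : {ae lebesgue_rV R d.-1, forall t, @unit_simplex R d t ->
        gammaD (facet_param F t) -> affine_field M c0 (facet_param F t) = 0}.
      exact: MD.
    by apply: filterS MDF => t h [Dt St]; exact: h.
  have [A0 b0] := rigid_facet_eq0 pq c0F cF d0 (card_cell c0) (skew c0)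
    (facet_vanishing cF mD FD aeD).
  by rewrite [LHS]surjective_pairing A0 b0.
apply/ffunP => c; rewrite [RHS]ffunE; apply/eqP; apply: contraT => Mc.
(* If [M] were nonzero on some cell, a cell of [K] would share a facet with a cell outside [K]. *)
pose K := [set c | M c == 0]%SET.
have [||c1 [c2 [c1K c2K c12]]] := cells_facet_connected (K := K) oOmega cOmega hT.
- by apply/set0Pn; exists c0; rewrite finset.inE Mc0.
- by apply/set0Pn; exists c; rewrite !finset.inE.
set E := cell c1 :&: cell c2 in c12.
have Ec1 : E \subset cell c1 by exact: finset.subsetIl.
have Ec2 : E \subset cell c2 by exact: finset.subsetIr.
have EI : E \in internal_facets T.
  rewrite inE c12 eqxx /=; apply/card_gt1P; exists c1, c2; split.
  - by rewrite inE.
  - by rewrite inE.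
  - by apply: contraNneq c2K => <-.
(* Each of the two cells is [cplus o E] or [cminus o E], and [M] takes the same value on both. *)
have M12 : M c1 = M c2.
  have := adj _ EI.
  have [->|->] := internal_facet_cells d0 hT ho EI Ec1;
  have [->|->] := internal_facet_cells d0 hT ho EI Ec2; done.
by move: c1K c2K; rewrite !finset.inE M12 => ->.
Qed.

End definiteness.

(** * Almost-everywhere statements on facets *)

Section ae_facet_theory.
Context {R : realType} {d : nat} {T : mesh R d}.
Implicit Types (F : {set 'I_(nvert T)}) (P Q : 'rV[R]_d -> Prop).

Lemma ae_facetW F P : (forall x, P x) -> ae_facet F P.
Proof. by move=> FP; apply: aeW => t _. Qed.

Lemma ae_facetS F P Q : (forall x, P x -> Q x) -> ae_facet F P -> ae_facet F Q.
Proof.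
move=> PQ aeP; have {}aeP : {ae lebesgue_rV R d.-1, forall t, @unit_simplex R d t ->
    P (facet_param F t)} := aeP.
by apply: filterS aeP => t + St => /(_ St)/PQ.
Qed.

Lemma ae_facetI F P Q : ae_facet F P -> ae_facet F Q ->
  ae_facet F (fun x => P x /\ Q x).
Proof.
move=> aeP aeQ; have {}aeP : {ae lebesgue_rV R d.-1, forall t, @unit_simplex R d t ->
    P (facet_param F t)} := aeP.
have {}aeQ : {ae lebesgue_rV R d.-1, forall t, @unit_simplex R d t ->
    Q (facet_param F t)} := aeQ.
by apply: filterS2 aeP aeQ => t Pt Qt St; split; [exact: Pt|exact: Qt].
Qed.

End ae_facet_theory.

(** A chosen projection is in [P1v] by definition, and so is the default value, the zero field. *)
Lemma pi_h_P1v {R : realType} {d : nat} (T : mesh R d) (f : 'rV[R]_d -> 'rV[R]_d) :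
  P1v (pi_h (T := T) f).
Proof.
rewrite /pi_h; case: xgetP => [p _ [] //|_].
apply/P1v_affine_field; exists 0; apply/funext => c; apply/funext => x.
by rewrite /affine_field ffunE /= mulmx0 addr0.
Qed.

Theorem proposition1 (R : realType) (d : nat) (hd : d = 2%N \/ d = 3%N)
    (Omega gammaD gammaN : set 'rV[R]_d)
    (hOmega : polyhedral_domain Omega)
    (hpart : gammaD `|` gammaN = boundary Omega)
    (hdisj : gammaD `&` gammaN = set0)
    (hD : closed gammaD)
    (hN : exists2 O : set 'rV[R]_d, open O & gammaN = boundary Omega `&` O)
    (T : mesh R d) (hT : matching_mesh_of T Omega)
    (hDpos : (0 < boundary_measure T gammaD)%E)
    (o : orientation T) (ho : well_oriented o)
    (lambda mu : R) (hC : hooke_posdef d lambda mu)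
    (eta zeta : R) (heta : 0 < eta) (hzeta : 0 < zeta)
    (a : R -> R)
    (ha_ge0 : forall x, 0 <= a x)
    (ha_C1 : (forall x, derivable a x 1) /\ continuous (derive1 a))
    (ha_mono : {in `[0, 1] &, {homo a : x y / x <= y}} \/
               {in `[0, 1] &, {homo a : x y /~ x <= y}})
    (ha0 : a 0 = 1) (ha1 : a 1 = 0)
    (w : 'rV[R]_d -> 'rV[R]_d) (hw : H12_vec Omega T w)
    (f : 'rV[R]_d -> 'rV[R]_d) (hf : H1_vec Omega f)
    (hfw : trace_eq_on Omega T gammaD f w)
    (alpha : field T R) (halpha : A_h o gammaD alpha) :
  exists! u : field T 'rV[R]_d,
    U_i_h gammaD f u /\
    forall v : field T 'rV[R]_d, U_0_h gammaD v ->
      form_h o lambda mu eta zeta a alpha u v = 0.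
Proof.
have d1 : (1 < d)%N by case: hd => ->.
have [[oO cO _] _ _ _] := hOmega.
have ca : continuous a.
  by move=> x; apply/differentiable_continuous/derivable1_diffP; have [] := ha_C1.
have [alpha1 _ _] := halpha.
pose B (M N : @coefs R d T) :=
  form_h o lambda mu eta zeta a alpha (affine_field M) (affine_field N).
have Bl N : scalar (B^~ N) := form_h_linearl o lambda mu eta zeta a alpha N.
have Br M : scalar (B M) := form_h_linearr o lambda mu eta zeta a alpha M.
pose P (M : @coefs R d T) := eq_on gammaD (affine_field M) (fun _ _ => 0).
have PD k M N : P M -> P N -> P (k *: M + N).
  move=> PM PN c F FB Fc; apply: ae_facetS (ae_facetI (PM c F FB Fc) (PN c F FB Fc)).
  move=> x [Mx Nx] Dx; rewrite affine_field_linear Mx// Nx//.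
  by rewrite scaler0 addr0.
have P0 : P 0.
  move=> c F FB Fc; apply: ae_facetW => x _.
  by rewrite /affine_field ffunE /= mulmx0 addr0.
have Bdef M : P M -> B M M = 0 -> M = 0.
  exact: (form_h_definite d1 oO cO hT ho hD hDpos hC heta hzeta ca ha_ge0 alpha1).
(* [pi_h f] itself is the lifting of the Dirichlet datum: the admissible fields are its translates
   by the subspace [P]. *)
have [M0 M0E] := (P1v_affine_field _).1 (@pi_h_P1v R d T f).
have Uv (N : @coefs R d T) : P N -> U_0_h gammaD (affine_field N).
  by move=> PN; split=> //; apply/P1v_affine_field; exists N.
(* The correction [w0] cancels the residual of the lifting, so [M0 + w0] solves the problem. *)
have [w0 Pw0 w0E] := definite_form_solvable P0 PD Bl Br (scalarN (Br M0)) Bdef.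
have shift M : U_i_h gammaD f (affine_field M) <-> P (M - M0).
  split=> [[_ eM] c F FB Fc|PM].
    apply: ae_facetS (eM c F FB Fc) => x h Dx.
    rewrite addrC -scaleN1r affine_field_linear h// M0E scaleN1r addNr.
    by [].
  split; first by apply/P1v_affine_field; exists M.
  move=> c F FB Fc; apply: ae_facetS (PM c F FB Fc) => x h Dx.
  apply/eqP; rewrite -subr_eq0 M0E -scaleN1r addrC -affine_field_linear.
  by rewrite scaleN1r addrC h.
exists (affine_field (M0 + w0)); split.
  split=> [|v [/P1v_affine_field[N ->] PN]].
    by apply/shift; rewrite addrC addKr.
  by rewrite -/(B _ N) -[M0]scale1r Bl w0E// mul1r subrr.
move=> u' [u'U u'0]; have [/P1v_affine_field[M' u'E] _] := u'U.
rewrite u'E in u'U u'0 *.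
have PM' : P (M' - M0) by exact/shift.
have PM'w : P (M' - (M0 + w0)).
  by rewrite opprD addrA addrC -scaleN1r; exact: PD.
(* The difference of the two solutions is itself a test field, and testing both equations with it
   makes the form vanish on the diagonal. *)
congr affine_field; apply/esym/eqP; rewrite -subr_eq0; apply/eqP/Bdef => //.
have := u'0 _ (Uv _ PM'w).
rewrite -/(B _ _) => BM'.
have -> : M' - (M0 + w0) = -1 *: (M0 + w0) + M' by rewrite scaleN1r addrC.
rewrite Bl.
have -> : B M' (-1 *: (M0 + w0) + M') = 0 by rewrite scaleN1r addrC.
by rewrite -[M0]scale1r Bl scale1r w0E ?mul1r ?subrr ?mulr0 ?addr0// scaleN1r addrC.
Qed.
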